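(* Let $\ell\ne p$ be a prime and let $e_i$ be the multiplicity of $\ell^i$ as an elementary divisor of the Laplacian matrix $L'$ of the Grassmann graph $\Gamma'$ on the $2$-dimensional subspaces of $V=\mathbb F_q^n$ ($n\ge4$, $q=p^t$). Put $f=[n]-1$ and $g=\left[\begin{smallmatrix}n\\2\end{smallmatrix}\right]_q-[n]$. In each case below, $e_i=0$ for all $i$ not listed. (A) Suppose $\ell\nmid q+1$. If $\ell\nmid[n]$ and $\ell\nmid[n-1]$, then $\ell\nmid|K(\Gamma')|$. Otherwise $\ell$ divides exactly one of $[n]$, $[n-1]$, and: (i) if $\ell\mid[n]$ and $\ell\nmid[n-1]$, with $a=v_\ell([n])$: $e_a=f-1$, $e_0=g+1$; (ii) if $\ell\nmid[n]$ and $\ell\mid[n-1]$, with $a=v_\ell([n-1])$: $e_a=g-1$, $e_0=f+1$. (B) Suppose $\ell\mid q+1$ and let $a=v_\ell(q+1)$. (i) If $\ell\nmid[n]$, $\ell\mid[n-1]$ (so $n$ is odd) and $\ell\nmid[(n-1)/2]_{q^2}$: $e_{2a}=g$, $e_0=f$. (ii) If $\ell\nmid[n]$, $\ell\mid[n-1]$ and $\ell\mid[(n-1)/2]_{q^2}$, with $b=v_\ell([(n-1)/2]_{q^2})$: $e_{2a+b}=g-1$, $e_{2a}=1$, $e_0=f$. (iii) If $\ell\mid[n]$, $\ell\nmid[n-1]$ (so $n$ is even), $\ell\nmid[n/2]_{q^2}$ and $\ell\nmid\lfloor\frac{n-1}{2}\rfloor$: $e_{2a}=f-1$, $e_a=g-f+2$,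 $e_0=f-1$. (iv) If $\ell\mid[n]$, $\ell\nmid[n-1]$ and $\ell\mid[n/2]_{q^2}$, with $b=v_\ell([n/2]_{q^2})$: $e_{2a+b}=f-1$, $e_a=g-f+2$, $e_0=f-1$. (v) If $\ell\mid[n]$, $\ell\nmid[n-1]$, $\ell\nmid[n/2]_{q^2}$ and $\ell\mid\lfloor\frac{n-1}{2}\rfloor$: $e_{2a}=f-1$, $e_a=g-f+2$, $e_0=f-1$.
   Context: Let $p$ be a prime, $q=p^t$ with $t\ge1$, $n\ge4$, and $V$ an $n$-dimensional vector space over $\mathbb F_q$. Notation: $[m]=\frac{q^m-1}{q-1}$, $[m]_{q^2}=\frac{q^{2m}-1}{q^2-1}$, and $\left[\begin{smallmatrix}m\\k\end{smallmatrix}\right]_q$ is the number of $k$-dimensional subspaces of $\mathbb F_q^m$; $v_\ell$ is the $\ell$-adic valuation. The Grassmann graph $\Gamma'$ has as vertices the $2$-dimensional subspaces of $V$, two distinct ones being adjacent when their intersection is nonzero. If $A'$ is its adjacency matrix and $k'$ its valency, $L'=k'I-A'$. The critical group $K(\Gamma')$ is the torsion subgroup of the cokernel of $L'$ over $\mathbb Z$. The multiplicity of $\ell^i$ as an elementary divisor of an integer matrix is the number of nonzero diagonal entries of its Smith normal form whose $\ell$-adic valuation is exactly $i$ (zero diagonal entries are not counted). *)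

(* Defs.v *)
From HB Require Import structures.
From mathcomp Require Import all_boot all_order all_algebra ring_quotient.
From mathcomp Require Import boolp classical_sets cardinality.

Set Implicit Arguments.
Unset Strict Implicit.
Unset Printing Implicit Defensive.

Import GRing.Theory.
Local Open Scope ring_scope.

(* A {vspace V} is encoded by a canonical square matrix spanning it, so over a
   finite field there are finitely many of them. *)
HB.instance Definition _ (F : finFieldType) (V : vectType F) :=
  CanIsCountable (@VectorInternalTheory.vs2mxK F V).
HB.instance Definition _ (F : finFieldType) (V : vectType F) :
    isFinite {vspace V} :=
  CanIsFinite (@VectorInternalTheory.vs2mxK F V).

Definition qint (q m : nat) : nat := ((q ^ m - 1) %/ (q - 1))%N.

Definition gauss_binom (F : finFieldType) (m k : nat) : nat :=
  #|[set U : {vspace 'rV[F]_m} | \dim U == k]|.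

(* The largest degree; for a regular graph, this is the common degree of
   the vertices. *)
Definition valency (T : finType) (e : rel T) : nat :=
  (\max_(x : T) #|[set y | e x y]|)%N.

Definition adjacency_mx (T : finType) (e : rel T) : 'M[int]_#|T| :=
  \matrix_(i, j) (e (enum_val i) (enum_val j))%:R.

(* k I - A: only meant for regular graphs. *)
Definition laplacian_mx (T : finType) (e : rel T) : 'M[int]_#|T| :=
  ((valency e)%:R)%:M - adjacency_mx e.

Definition grassmann_vertex (F : finFieldType) (V : vectType F) : finType :=
  {U : {vspace V} | \dim U == 2%N}.

Definition grassmann_adj (F : finFieldType) (V : vectType F) :
    rel (grassmann_vertex V) :=
  fun U W => (U != W) && ((val U :&: val W)%VS != 0%VS).

Definition grassmann_laplacian (F : finFieldType) (V : vectType F) :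
    'M[int]_#|grassmann_vertex V| :=
  laplacian_mx (@grassmann_adj F V).

Definition im_mx m n (M : 'M[int]_(m, n)) : {pred 'cV[int]_m} :=
  fun v => `[< exists u : 'cV[int]_n, v = M *m u >].

Lemma im_mx_zmod_closed m n (M : 'M[int]_(m, n)) : zmod_closed (im_mx M).
Proof.
split=> [|v w /asboolP[x ->] /asboolP[y ->]]; apply/asboolP.
  by exists 0; rewrite mulmx0.
by exists (x - y); rewrite mulmxBr.
Qed.

HB.instance Definition _ m n (M : 'M[int]_(m, n)) :=
  GRing.isZmodClosed.Build 'cV[int]_m (im_mx M) (im_mx_zmod_closed M).

Definition cokernel m n (M : 'M[int]_(m, n)) : zmodType :=
  {ideal_quot (im_mx M)}.

Definition torsion (G : zmodType) : set G :=
  [set x | exists2 k : nat, (0 < k)%N & x *+ k = 0]%classic.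
Arguments torsion : clear implicits.

Definition critical_group m n (M : 'M[int]_(m, n)) : set (cokernel M) :=
  torsion (cokernel M).
Arguments critical_group {m n} M.

Definition has_order (T : Type) (A : set T) (N : nat) : Prop :=
  (A #= `I_N)%card.

(* d lists the diagonal of a Smith normal form of M.  The signs of the
   entries are not normalized; valuations do not depend on them. *)
Definition smith_diagonal m n (M : 'M[int]_(m, n)) (d : seq int) : Prop :=
  [/\ size d = minn m n, sorted dvdz d &
   exists L R, [/\ L \in unitmx, R \in unitmx &
     M = L *m (\matrix_(i < m, j < n) (d`_i *+ (i == j :> nat))) *m R]].

Lemma smith_diagonal_exists m n (M : 'M[int]_(m, n)) :
  exists d, smith_diagonal M d.
Proof.
have [L uL [R uR [d sd defM]]] := int_Smith_normal_form M.
exists (mkseq (nth 0 d) (minn m n)); split; first by rewrite size_mkseq.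
  apply/(sortedP 0) => i; rewrite size_mkseq => lti.
  rewrite !nth_mkseq ?(ltnW lti) //.
  have [ltid | leid] := ltnP i.+1 (size d); first exact: (sortedP 0 sd).
  by rewrite (nth_default _ leid); exact: dvdz0.
exists L, R; split=> //; rewrite {1}defM; congr (_ *m _ *m _).
apply/matrixP=> i j; rewrite !mxE.
have [eqij | _] := eqVneq (i : nat) (j : nat); last by rewrite !mulr0n.
by rewrite nth_mkseq // leq_min ltn_ord {1}eqij ltn_ord.
Qed.

(* logn l 0 = 0, hence the explicit exclusion of zero entries. *)
Definition elemdiv_mult (l : nat) (d : seq int) (i : nat) : nat :=
  count (fun x : int => (x != 0) && (logn l `|x|%N == i)) d.

(* e takes the values listed in s, a sequence of pairs (i, e i), and
   vanishes elsewhere. *)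
Definition mult_are (e : nat -> nat) (s : seq (nat * nat)) : Prop :=
  (forall c, c \in s -> e c.1 = c.2) /\
  (forall i, i \notin unzip1 s -> e i = 0%N).

(* Main.v *)
(** The lines (2-spaces) and points (1-spaces) of V form a Steiner system: the
    incidence matrix B satisfies B^T B = (r - 1) I + J and B 1 = k 1 with
    k = q + 1, r = [n - 1], and P = [n] points; the Laplacian of the Grassmann
    graph is L = k r I - B B^T.  The nonzero eigenvalues of L give the product of
    its nonzero invariant factors.  Lower bounds on how many invariant factors
    are divisible by a power of l come from exhibiting matrices of small rank
    congruent to L, and, for the largest power when l divides q + 1 and [n], from
    an explicit l-pure lattice of vectors on which L is very divisible.  In every
    case these bounds add up to the valuation of the product, so all of them are
    equalities. *)

Require Import Defs.
From mathcomp Require Import all_boot all_order all_algebra finfield.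
From mathcomp Require Import ring zify.
From mathcomp Require Import boolp classical_sets cardinality.

(** * Divisibility of Smith diagonal entries by prime powers *)

Section SmithDivisibility.

Set Implicit Arguments.
Unset Strict Implicit.
Unset Printing Implicit Defensive.
Import Order.TTheory GRing.Theory Num.Theory.
Local Open Scope ring_scope.

(** Over the rationals [L] has eigenvalue k r on the kernel of [B^T], P on the images under [B] of
    sum-zero vectors and 0 on constants. The integral eigenlattices need not fill the whole lattice
    at [l], so these valuations need not be those of the invariant factors. The worst case is [l]
    dividing both q + 1 and [n]: with a = v(q + 1) and b = v([n/2]_{q^2}) the eigenvalues have
    valuations a and a + b, while the exponent 2a + b occurs f - 1 times, so no congruence modulo
    one eigenvalue can detect it. What does is the identity L (P + B B^T) = P k r I - k^2 J, with J
    the all-ones matrix: it makes [L] divisible by P k r on a lattice of sum-zero vectors. Enough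
    vectors independent modulo [l] come from differences of two pencils of lines in a projective
    plane; these introduce the constant q, which is prime to [l]. The product of the nonzero
    invariant factors is obtained without diagonalization, from det(L + J) and Sylvester's
    identity. *)

Lemma smith_diagonal_dvd m n (M : 'M[int]_(m, n)) d i j :
  smith_diagonal M d -> (i <= j)%N -> (j < minn m n)%N -> (d`_i %| d`_j)%Z.
Proof.
case=> sz srt _ ij jn.
by apply: (sorted_leq_nth dvdz_trans dvdzz 0 srt); rewrite ?inE ?sz // (leq_ltn_trans ij).
Qed.

Lemma dvdz_sum_mulmx (c : int) m n p (A : 'M[int]_(m, n)) (B : 'M_(n, p)) :
  (forall i j, c %| B i j)%Z -> forall i j, (c %| (A *m B) i j)%Z.
Proof. by move=> cB i j; rewrite mxE rpred_sum // => h _; rewrite dvdz_mull. Qed.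

Lemma prime_pow_dvdzMr (l k : nat) (x y : int) :
  prime l -> ~~ ((l ^ k)%N%:Z %| x)%Z -> ((l ^ k)%N%:Z %| x * y)%Z -> (l %| y)%Z.
Proof.
move=> pl; rewrite !dvdzE abszM !absz_nat => nx; apply: contraLR => ny.
rewrite Gauss_dvdl // coprimeXl // prime_coprime //.
Qed.

(** The [c] columns of [X] stay independent modulo [l], as [T] certifies, and [M] kills them modulo
    [l ^ k]. If [d_i] were not divisible by [l ^ k], neither would any earlier entry be, so the
    first i + 1 rows of [R *m X] would vanish modulo [l], leaving fewer than [c] rows to carry rank
    [c]. *)
Lemma smith_dvd_of_columns (l k N c : nat) (M : 'M[int]_N) d
    (X : 'M_(N, c)) (T : 'M_(c, N)) :
  prime l -> smith_diagonal M d ->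
  (forall i j, (l ^ k)%N%:Z %| (M *m X) i j)%Z ->
  ~~ (l %| \det (T *m X))%Z ->
  forall i, (N - c <= i < N)%N -> ((l ^ k)%N%:Z %| d`_i)%Z.
Proof.
move=> pl smd; have [_ _ [L [R [uL uR defM]]]] := smd.
set D := \matrix_(_, _) _ in defM.
move=> lMX ndet i /andP[ci iN]; apply/negPn/negP => ndi.
have DRX : D *m (R *m X) = invmx L *m (M *m X).
  by rewrite defM !mulmxA mulVmx // mul1mx.
have rowX (j : 'I_N) h : (j <= i)%N -> (l %| (R *m X) j h)%Z.
  move=> ji; have nj : ~~ ((l ^ k)%N%:Z %| d`_j)%Z.
    apply: contra ndi => dj; apply: dvdz_trans dj _.
    by apply: (smith_diagonal_dvd smd) => //; rewrite minnn.
  apply: (prime_pow_dvdzMr pl nj).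
  have := dvdz_sum_mulmx (invmx L) lMX j h; rewrite -DRX mxE.
  rewrite (bigD1 j) //= big1 ?addr0 ?mxE ?eqxx // => g gj.
  by rewrite !mxE eq_sym [(_ == _ :> nat)]val_eqE (negPf gj) mul0r.
have pF := pchar_Fp pl.
pose phi := map_mx (intr : int -> 'F_l).
have lt_rank : (\rank (phi _ _ (R *m X)) <= N - i.+1)%N.
  have -> : phi _ _ (R *m X) = copid_mx i.+1 *m phi _ _ (R *m X).
    apply/matrixP=> j h; rewrite mulmxBl mul1mx.
    rewrite [RHS]mxE -[LHS]addr0; congr (_ + _); rewrite mxE mxE big1 ?oppr0 // => g _.
    have [gi|gi] := leqP g i; last first.
      rewrite !mxE ltnS; have [->|] := eqVneq (j : nat) g; rewrite ?mul0r //.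
      by rewrite leqNgt gi mul0r.
    have := rowX g h gi; rewrite (dvdz_pcharf pF) => /eqP.
    by rewrite [phi _ _ _ _ _]mxE => ->; rewrite mulr0.
  by apply: leq_trans (mxrankM_maxl _ _) _; rewrite rank_copid_mx.
have : (\det (T *m X))%:~R != 0 :> 'F_l by rewrite -(dvdz_pcharf pF).
rewrite -det_map_mx -unitfE -[_ \is a _]/(_ \in unitmx) => /mxrank_unit rk.
have : (c <= N - i.+1)%N.
  rewrite -{1}rk -[X]mul1mx -(mulVmx uR) -mulmxA mulmxA map_mxM /=.
  exact: leq_trans (mxrankM_maxr _ _) lt_rank.
by rewrite leqNgt ltn_subLR // addSn ltnS addnC -leq_subLR ci.
Qed.

Lemma map_mx_unit (R S : comUnitRingType) (h : {rmorphism R -> S}) n (A : 'M_n) :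
  A \in unitmx -> map_mx h A \in unitmx.
Proof. by rewrite !unitmxE det_map_mx; apply: rmorph_unit. Qed.

(** Unimodular factors preserve the rational rank, so it equals the number of nonzero diagonal
    entries, and divisibility puts the zeros last. *)
Lemma smith_rank_nth0 (N s : nat) (Y : 'M[int]_N) (L R : 'M_N) (d : seq int) :
  L \in unitmx -> R \in unitmx -> sorted dvdz d ->
  Y = L *m (\matrix_(i, j) (d`_i *+ (i == j :> nat))) *m R ->
  (\rank (map_mx (intr : int -> rat) Y) <= s)%N ->
  forall i, (s <= i < N)%N -> d`_i = 0.
Proof.
move=> uL uR sd defY rkY i /andP[si iN]; apply/eqP/negPn/negP => di0.
have isz : (i < size d)%N by rewrite ltnNge; apply: contra di0 => h; rewrite nth_default.
have dj0 j : (j <= i)%N -> d`_j != 0.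
  move=> ji; apply: contra di0 => /eqP dj.
  have := sorted_leq_nth dvdz_trans dvdzz 0 sd j i (leq_ltn_trans ji isz) isz ji.
  by rewrite dj dvd0z.
set D := \matrix_(_, _) _ in defY.
pose E : 'M[rat]_N := \matrix_(a, b) ((d`_a)%:~R^-1 *+ ((a == b) && (a <= i)%N)).
have DE : map_mx intr D *m E = pid_mx i.+1.
  apply/matrixP=> a b; rewrite mxE (bigD1 a) //= big1 ?addr0 => [|h ha]; last first.
    by rewrite !mxE eq_sym [(_ == _ :> nat)]val_eqE (negPf ha) mulr0n mul0r.
  rewrite !mxE eqxx ltnS mulr1n val_eqE; case: (a == b); rewrite ?mulr0 //=.
  by case: leqP => ai; rewrite ?mulr0 // mulr1n mulfV // intr_eq0 dj0.
have : (i.+1 <= \rank (map_mx (intr : int -> rat) D))%N.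
  rewrite -(@rank_pid_mx rat N N i.+1) // -DE; exact: mxrankM_maxl.
apply/negP; rewrite -leqNgt; apply: leq_trans si; apply: leq_trans rkY.
rewrite defY !map_mxM /=.
rewrite mxrankMfree ?row_free_unit ?map_mx_unit //.
rewrite -(mxrank_tr (_ *m _)) trmx_mul mxrankMfree ?mxrank_tr //.
by rewrite row_free_unit unitmx_tr map_mx_unit.
Qed.

(** The Smith form of [Y] exhibits [N - s] kernel vectors as the last columns of [invmx R1], which
    are independent modulo every prime; on them [u *: M] is divisible by [l ^ k]. The factor [u], a
    unit at [l], clears denominators from the congruence. *)
Lemma smith_dvd_of_rank (l k N s : nat) (M Y : 'M[int]_N) (u : int) d :
  prime l -> smith_diagonal M d -> ~~ (l %| u)%Z ->
  (forall i j, (l ^ k)%N%:Z %| (u *: M - Y) i j)%Z ->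
  (\rank (map_mx (intr : int -> rat) Y) <= s)%N ->
  forall i, (s <= i < N)%N -> ((l ^ k)%N%:Z %| d`_i)%Z.
Proof.
move=> pl smd nu cong rkY i /andP[si iN].
have sN : (s <= N)%N := leq_trans si (ltnW iN).
have [L1 uL1 [R1 uR1 [d1 sd1 defY]]] := int_Smith_normal_form Y.
have d10 := smith_rank_nth0 uL1 uR1 sd1 defY rkY.
set D1 := \matrix_(_, _) _ in defY.
(* [Z] selects the last [N - s] coordinates, where [D1] is zero. *)
pose Z : 'M[int]_(N, N - s) := \matrix_(a, b) (a == s + b :> nat)%N%:R.
have ZtZ : Z^T *m Z = 1%:M.
  apply/matrixP=> a b; rewrite mxE.
  have aN : (s + a < N)%N by rewrite -ltn_subRL ltn_ord.
  rewrite (bigD1 (Ordinal aN)) //= big1 ?addr0 => [|h ha].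
    by rewrite !mxE /= eqxx mul1r eqn_add2l.
  by rewrite !mxE; move: ha; rewrite -val_eqE /= => /negPf ->; rewrite mul0r.
apply: (@smith_dvd_of_columns l k N (N - s) M d (invmx R1 *m Z) (Z^T *m R1)) => //.
- move=> a b; rewrite -(@Gauss_dvdzr _ u); last first.
    by rewrite coprimezE absz_nat coprimeXl // prime_coprime.
  have -> : u * (M *m (invmx R1 *m Z)) a b
          = (((u *: M - Y) *m (invmx R1 *m Z)) a b).
    rewrite mulmxBl -scalemxAl defY.
    suff -> : L1 *m D1 *m R1 *m (invmx R1 *m Z) = 0.
      by rewrite subr0 [RHS]mxE.
    rewrite !mulmxA mulmxK //.
    rewrite -mulmxA.
    suff -> : D1 *m Z = 0 by rewrite mulmx0.
    apply/matrixP=> e f; rewrite !mxE big1 // => h _; rewrite !mxE.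
    have [eh|] := eqVneq (e : nat) h; last by rewrite mul0r.
    have [hf|] := eqVneq (h : nat) (s + f)%N; last by rewrite mulr0.
    rewrite d10 ?mul0rn ?mul0r // eh hf leq_addr /= -ltn_subRL //.
  rewrite mxE rpred_sum // => h _; exact: dvdz_mulr.
- by rewrite mulmxA mulmxK // ZtZ det1 dvdzE absz1 dvdn1 neq_ltn prime_gt1 // orbT.
- by rewrite subKn // si.
Qed.

End SmithDivisibility.

(** * Product of the nonzero invariant factors when row and column sums vanish *)

Section LaplacianSmith.

Set Implicit Arguments.
Unset Strict Implicit.
Unset Printing Implicit Defensive.
Import Order.TTheory GRing.Theory Num.Theory.
Local Open Scope ring_scope.

Lemma abszM_eq1 (x y : int) : x * y = 1 -> `|x|%N = 1%N.
Proof.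
move=> xy; apply/eqP; have := congr1 absz xy; rewrite abszM => /eqP.
by rewrite muln_eq1 => /andP[].
Qed.

Lemma absz_det_unitmx n (A : 'M[int]_n) : A \in unitmx -> `|\det A|%N = 1%N.
Proof.
by rewrite unitmxE => /mulrV; apply: abszM_eq1.
Qed.

(** The row of column sums of [L] is [z] times the last basis vector, and unimodularity makes [z]
    equal to 1 or -1. Multiplying this row by [invmx L] times the all-ones column gives back the
    number of ones. *)
Lemma absz_inv_row_sum m (L : 'M[int]_m.+1) :
  L \in unitmx ->
  (forall j, j != ord_max -> ((const_mx 1 : 'rV[int]_m.+1) *m L) 0 j = 0) ->
  `|((invmx L *m (const_mx 1 : 'cV[int]_m.+1)) ord_max 0)%R|%N = m.+1.
Proof.
move=> uL z0; pose u : 'rV[int]_m.+1 := const_mx 1 *m L; pose z := u 0 ord_max.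
have uM (n : nat) (C : 'M_(m.+1, n)) j : (u *m C) 0 j = z * C ord_max j.
  rewrite mxE (bigD1 ord_max) //= big1 ?addr0 // => h /z0.
  by rewrite -/u => ->; rewrite mul0r.
have z1 : `|z|%N = 1%N.
  by apply: (@abszM_eq1 _ (invmx L ord_max 0)); rewrite -uM mulmxK ?mxE.
have := uM 1%N (invmx L *m const_mx 1) 0.
rewrite mulmxA mulmxK // mxE => /(congr1 absz).
rewrite abszM z1 mul1n => <-.
under eq_bigr do rewrite !mxE mulr1.
by rewrite sumr_const card_ord natz.
Qed.

(** A form of the matrix-tree theorem. In Smith coordinates the all-ones matrix is the rank one
    matrix [a *m b], and as the last diagonal entry is 0, the determinant is the product of the
    other entries times the last entries of [a] and [b]. Each of these is [m.+1] up to sign, whence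
    the square. *)
Lemma smith_laplacian m (M : 'M[int]_m.+1) d :
  smith_diagonal M d ->
  M *m (const_mx 1 : 'cV[int]_m.+1) = 0 -> (const_mx 1 : 'rV[int]_m.+1) *m M = 0 ->
  \det (M + const_mx 1) != 0 ->
  d`_m = 0 /\
  (`|(\prod_(i < m) d`_i)%R| * m.+1 ^ 2)%N = `|(\det (M + const_mx 1))%R|%N.
Proof.
move=> smd M1 M1l det0; have [_ _ [L [R [uL uR defM]]]] := smd.
set D := \matrix_(_, _) _ in defM.
pose c1 : 'cV[int]_m.+1 := const_mx 1; pose r1 : 'rV[int]_m.+1 := const_mx 1.
have DR1 (j : 'I_m.+1) : d`_j * (R *m c1) j 0 = 0.
  have : D *m (R *m c1) = 0.
    by apply: (can_inj (mulKmx uL)); rewrite mulmx0 !mulmxA -defM.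
  move=> /matrixP/(_ j 0); rewrite mxE (bigD1 j) //= big1 ?addr0 => [|h].
    by rewrite !mxE eqxx.
  by rewrite !mxE eq_sym -val_eqE /= => /negPf ->; rewrite mul0r.
have LD1 (j : 'I_m.+1) : (r1 *m L) 0 j * d`_j = 0.
  have : (r1 *m L) *m D = 0.
    by apply: (can_inj (mulmxK uR)); rewrite mul0mx -mulmxA -mulmxA -defM.
  move=> /matrixP/(_ 0 j); rewrite mxE (bigD1 j) //= big1 ?addr0 => [|h].
    by rewrite [D _ _]mxE eqxx [RHS]mxE.
  by rewrite [D _ _]mxE -val_eqE /= => /negPf ->; rewrite mulr0.
have dm : d`_m = 0.
  have : R *m c1 != 0.
    apply: contraTneq isT => /(congr1 (mulmx (invmx R))).
    by rewrite mulKmx // mulmx0 => /matrixP/(_ 0 0); rewrite !mxE.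
  case/matrix0Pn=> j [z Rj]; have /eqP := DR1 j.
  rewrite (ord1 z) in Rj; rewrite mulf_eq0 (negPf Rj) orbF => /eqP dj.
  apply/eqP; rewrite -dvd0z -[X in (X %| _)%Z]dj; apply: (smith_diagonal_dvd smd).
    by rewrite -ltnS ltn_ord.
  by rewrite minnn.
split=> //; set a := invmx L *m c1; set b := r1 *m invmx R.
have defMJ : M + const_mx 1 = L *m (D + a *m b) *m R.
  rewrite mulmxDr mulmxDl -defM; congr (_ + _).
  rewrite /a /b !mulmxA mulmxV // mul1mx mulmxKV //.
  by apply/matrixP=> i j; rewrite !mxE big_ord1 !mxE mulr1.
(* A triangular factorization: [a] is the last column of [E] and [b] the last row of [F]. The last
   row of the product is right because [d_m] is 0. *)
pose E : 'M[int]_m.+1 :=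
  \matrix_(i, j) (if j == ord_max then a i 0 else (i == j)%:R).
pose F : 'M[int]_m.+1 :=
  \matrix_(i, j) (if i == ord_max then b 0 j else d`_i *+ (i == j)).
have EF : D + a *m b = E *m F.
  apply/matrixP=> i j; rewrite !mxE [X in _ + X = _]big_ord1 [RHS]big_ord_recr /=.
  rewrite !mxE eqxx; congr (_ + _).
  have [-> | ni] := eqVneq i ord_max.
    rewrite /= dm mul0rn big1 // => h _; rewrite !mxE.
    by rewrite -!val_eqE /= (ltn_eqF (ltn_ord h)) (gtn_eqF (ltn_ord h)) mul0r.
  have im : (i < m)%N.
    by rewrite ltn_neqAle -[X in (_ <= X)%N]/(m) -ltnS ltn_ord andbT; exact: ni.
  rewrite (bigD1 (Ordinal im)) //= big1 ?addr0 => [|h hi].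
    rewrite !mxE -!val_eqE /= (ltn_eqF im) eqxx mul1r.
    by case: (_ == _).
  rewrite !mxE -!val_eqE /= (ltn_eqF (ltn_ord h)).
  by move: hi; rewrite -val_eqE /= eq_sym => /negPf ->; rewrite mul0r.
have detE : \det E = a ord_max 0.
  rewrite -det_tr det_trig; last first.
    apply/is_trig_mxP=> i j ij; rewrite !mxE -!val_eqE /=.
    have im : (i < m)%N by apply: leq_trans ij _; rewrite -ltnS.
    by rewrite (ltn_eqF im) (gtn_eqF ij).
  rewrite big_ord_recr /= big1 ?mul1r => [|i _]; first by rewrite !mxE eqxx.
  by rewrite !mxE -val_eqE /= (ltn_eqF (ltn_ord i)) eqxx.
have detF : \det F = (\prod_(i < m) d`_i) * b 0 ord_max.
  rewrite det_trig; last first.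
    apply/is_trig_mxP=> i j ij; rewrite !mxE -!val_eqE /=.
    have im : (i < m)%N by apply: leq_trans ij _; rewrite -ltnS.
    by rewrite (ltn_eqF im) (ltn_eqF ij).
  rewrite big_ord_recr /=; congr (_ * _); last by rewrite !mxE eqxx.
  by apply: eq_bigr => i _; rewrite !mxE -val_eqE /= (ltn_eqF (ltn_ord i)) eqxx.
have detMJ : \det (M + const_mx 1)
           = \det L * (a ord_max 0 * ((\prod_(i < m) d`_i) * b 0 ord_max)) * \det R.
  by rewrite defMJ !det_mulmx EF det_mulmx detE detF.
(* The determinant is a multiple of the first [m] entries, so these are nonzero; [LD1] and [DR1]
   then make all column sums of [L] and all row sums of [R] vanish except the last. *)
have dj0 (j : 'I_m.+1) : j != ord_max -> d`_j != 0.
  move=> jm; have jm' : (j < m)%N.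
    by rewrite ltn_neqAle -ltnS ltn_ord andbT; exact: jm.
  move: det0; rewrite detMJ; apply: contraNneq => dj.
  by rewrite (bigD1 (Ordinal jm')) //= dj !(mul0r, mulr0).
rewrite detMJ !abszM !absz_det_unitmx // mul1n muln1.
rewrite absz_inv_row_sum //; last first.
  by move=> j /dj0 dj; have /eqP := LD1 j; rewrite mulf_eq0 (negPf dj) orbF => /eqP.
suff -> : `|b 0%R ord_max|%N = m.+1 by rewrite mulnCA mulnA mulnC mulnA.
have -> : b 0 ord_max = (invmx R^T *m c1) ord_max 0.
  rewrite -trmx_inv -[c1]trmxK -trmx_mul [RHS]mxE; congr (_ 0 _).
  by congr (_ *m _); apply/matrixP=> i j; rewrite !mxE.
apply: absz_inv_row_sum; first by rewrite unitmx_tr.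
move=> j /dj0 dj; have /eqP := DR1 j; rewrite mulf_eq0 (negPf dj) /= => /eqP <-.
rewrite -[X in X *m _]trmxK -trmx_mul [LHS]mxE; congr ((_ *m _) _ _).
by apply/matrixP=> i k; rewrite !mxE.
Qed.

End LaplacianSmith.

(** * Order of the torsion subgroup of the cokernel *)

Section CriticalGroupOrder.

Set Implicit Arguments.
Unset Strict Implicit.
Unset Printing Implicit Defensive.
Import Order.TTheory GRing.Theory Num.Theory.
Local Open Scope ring_scope.
Local Open Scope quotient_scope.

Lemma pi_cokernelE m n (M : 'M[int]_(m, n)) (v w : 'cV_m) :
  (\pi_(cokernel M) v = \pi_(cokernel M) w) <-> (exists u, v - w = M *m u).
Proof.
split=> [/eqP | vw]; first by rewrite -Quotient.idealrBE => /asboolP.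
by apply/eqP; rewrite -Quotient.idealrBE; apply/asboolP.
Qed.

Lemma card_finType_II (T : finType) : ([set: T]%classic #= `I_#|T|)%card.
Proof.
apply: card_esym; apply: card_eq_trans card_II _.
have -> : [set: T]%classic = [set enum_val i | i in [set: 'I_#|T|]]%classic.
  by rewrite predeqE => x; split=> // _; exists (enum_rank x); rewrite ?enum_rankK.
by apply: card_esym; apply: inj_card_eq => i j _ _; apply: enum_val_inj.
Qed.

(** In Smith coordinates the cokernel is a direct sum of cyclic groups, and vectors of least
    residues modulo the nonzero [d_i] list its torsion without repetition. *)
Lemma critical_group_order N (M : 'M[int]_N) d :
  smith_diagonal M d ->
  has_order (critical_group M) (\prod_(x <- d | x != 0) `|x|)%N.
Proof.
case=> sz sd [L [R [uL uR]]]; set D := \matrix_(_, _) _ => defM.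
(* A zero entry gives an infinite cyclic summand, whose only torsion element is 0: one residue. *)
pose c (i : 'I_N) := (if (d`_i == 0)%R then 1 else `|(d`_i)%R|)%N.
have c_gt0 i : (0 < c i)%N by rewrite /c; case: eqP => // /eqP; rewrite absz_gt0.
pose X := {dffun forall i : 'I_N, 'I_(c i)}.
pose vec (x : X) : 'cV[int]_N := \col_i (x i : nat)%:Z.
pose phi (x : X) : cokernel M := \pi_(cokernel M) (L *m vec x).
have DE (u : 'cV[int]_N) i : (D *m u) i 0 = d`_i * u i 0.
  rewrite mxE (bigD1 i) //= big1 ?addr0 => [|h]; first by rewrite mxE eqxx.
  by rewrite !mxE eq_sym -val_eqE /= => /negPf ->; rewrite mul0r.
have phiE z w : \pi_(cokernel M) (L *m z) = \pi_(cokernel M) (L *m w) <->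
    (forall i, (d`_i %| (z - w) i 0%R)%Z).
  rewrite pi_cokernelE -mulmxBr; split=> [[u] | dv].
    rewrite defM -!mulmxA => /(can_inj (mulKmx uL)) -> i.
    by rewrite DE dvdz_mulr.
  exists (invmx R *m \col_i ((z - w) i 0%R %/ d`_i)%Z).
  rewrite defM -!mulmxA mulKVmx //; congr (_ *m _).
  apply/matrixP=> i j; rewrite (ord1 j) DE [X in _ = _ * X]mxE mulrC divzK //.
have ord_c0 i (h : 'I_(c i)) : d`_i = 0 -> (h : nat) = 0%N.
  move=> di; have ci1 : c i = 1%N by rewrite /c di eqxx.
  by have := ltn_ord h; rewrite [X in (_ < X)%N]ci1 ltnS leqn0 => /eqP.
have ord_c i (h : 'I_(c i)) : d`_i != 0 -> (h < `|(d`_i)%R|)%N.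
  move=> /negPf di; have ci1 : c i = `|(d`_i)%R|%N by rewrite /c di.
  by have := ltn_ord h; rewrite [X in (_ < X)%N]ci1.
have inj_phi : injective phi.
  move=> x y /phiE dxy; apply/ffunP=> i; apply: ord_inj.
  have := dxy i; rewrite !mxE.
  have [di _| di] := eqVneq (d`_i) 0; first by rewrite !ord_c0.
  rewrite -eqz_mod_dvd -!(modz_abs _ d`_i).
  by rewrite !modz_nat !modn_small ?ord_c // => /eqP[].
have -> : (\prod_(x <- d | x != 0) `|x|)%N = #|X|.
  rewrite card_dep_ffun foldrE big_image /= (big_nth 0) sz minnn big_mkcond big_mkord.
  by apply: eq_bigr => i _; rewrite card_ord /c; case: eqP.
rewrite /has_order.
apply: card_eq_trans (card_finType_II X).
have -> : critical_group M = [set phi x | x in [set: X]]%classic.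
  rewrite predeqE => v; split.
    case=> k k0; rewrite -[v]reprK; set w := repr v.
    rewrite -[w](mulKVmx uL); move: (invmx L *m w) => z hk.
    have dz (i : 'I_N) : d`_i = 0 -> z i 0 = 0.
      have : \pi_(cokernel M) (L *m (z *+ k)) = \pi_(cokernel M) (L *m 0).
        by rewrite mulmx0 (raddfMn (mulmx L)) (raddfMn \pi_{ideal_quot (im_mx M)}) hk (raddf0 \pi_{ideal_quot (im_mx M)}).
      move/phiE/(_ i); rewrite subr0 => + di; rewrite di dvd0z.
      by rewrite mulmxnE mulrn_eq0 eqn0Ngt k0 /= => /eqP.
    have lt_c (i : 'I_N) : (`|((z i 0%R %% (d`_i)%R)%Z)|%N < c i)%N.
      rewrite /c; case: eqP => [di|/eqP di]; first by rewrite di modz0 (dz _ di).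
      by rewrite -ltz_nat gez0_abs ?modz_ge0 // ltz_mod.
    exists (finfun (fun i => Ordinal (lt_c i)) : X) => //.
    apply/phiE => i; rewrite !mxE ffunE /=.
    have [di|di] := eqVneq (d`_i) 0; first by rewrite di (dz _ di) modz0 subrr dvdz0.
    rewrite gez0_abs ?modz_ge0 // {2}(divz_eq (z i 0%R) (d`_i)).
    by rewrite opprD addrCA subrr addr0 rpredN dvdz_mull.
  case=> x _ <-; exists (\prod_i c i)%N; first by rewrite prodn_gt0.
  rewrite -(raddfMn \pi_{ideal_quot (im_mx M)}) -(raddfMn (mulmx L)).
  apply: etrans _ (raddf0 \pi_{ideal_quot (im_mx M)}).
  rewrite -[X in _ = \pi X](mulmx0 _ L); apply/phiE => i; rewrite subr0 mulmxnE mxE.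
  have [di|/negPf di] := eqVneq (d`_i) 0; first by rewrite ord_c0 // mul0rn dvdz0.
  have ci : c i = `|(d`_i)%R|%N by rewrite /c di.
  rewrite (bigD1 i) //= [X in (X * _)%N]ci mulnC mulrnA -mulr_natr natz dvdz_mull //.
  by rewrite dvdzE.
by apply: inj_card_eq => x y _ _; apply: inj_phi.
Qed.

End CriticalGroupOrder.

(** * From lower bounds on valuations to exact multiplicities *)

Section ElementaryDivisors.

Set Implicit Arguments.
Unset Strict Implicit.
Unset Printing Implicit Defensive.
Import Order.TTheory GRing.Theory Num.Theory.

Lemma absz_prod n (F : 'I_n -> int) :
  (`|(\prod_(i < n) F i)%R| = \prod_(i < n) `|F i|)%N.
Proof. exact: (big_morph absz abszM). Qed.

Lemma logn_prod_ord l n (F : 'I_n -> nat) :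
  (forall i, 0 < F i) -> logn l (\prod_(i < n) F i) = \sum_(i < n) logn l (F i).
Proof.
elim: n F => [|n IH] F F0; first by rewrite !big_ord0 logn1.
by rewrite !big_ord_recr /= lognM ?IH // prodn_gt0.
Qed.

(** Valuations bounded below termwise by [s], with the same total as [s], are equal to [s]. The list
    [d] is one longer than [s] because its last entry is 0, which is not counted. *)
Lemma elemdiv_mult_of_bounds (l m : nat) (d : seq int) (s : seq nat) :
  prime l -> size d = m.+1 -> (d`_m = 0)%R ->
  (\prod_(i < m) d`_i != 0)%R -> size s = m ->
  (forall i, i < m -> ((l ^ nth 0 s i)%N%:Z %| (d`_i)%R)%Z) ->
  logn l `|(\prod_(i < m) d`_i)%R| = sumn s ->
  forall j, elemdiv_mult l d j = count_mem j s.
Proof.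
move=> pl szd dm prod0 szs bound tot j.
have d0 (i : 'I_m) : 0 < `|(d`_i)%R|%N.
  rewrite absz_gt0; apply: contra prod0 => di.
  by rewrite (bigD1 i) //= (eqP di) mul0r.
have bnd (i : 'I_m) : nth 0 s i <= logn l `|(d`_i)%R|.
  by rewrite -pfactor_dvdn // -[X in X %| _]absz_nat -dvdzE bound.
have eqv (i : 'I_m) : logn l `|(d`_i)%R| = nth 0 s i.
  have /leqif_sum : forall i : 'I_m, true ->
      nth 0 s i <= logn l `|(d`_i)%R| ?= iff (nth 0 s i == logn l `|(d`_i)%R|).
    by move=> h _; split.
  case=> _; rewrite -logn_prod_ord // -absz_prod tot.
  rewrite sumnE (big_nth 0) szs big_mkord eqxx => /esym/forallP/(_ i) /=.
  by move/eqP.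
rewrite /elemdiv_mult -!sum1_count (big_nth 0%R) [RHS](big_nth 0) szs szd.
rewrite !big_mkord big_mkcond [RHS]big_mkcond big_ord_recr /= dm eqxx /= addn0.
apply: eq_bigr => i _; rewrite eqv; congr (if _ then _ else _).
by rewrite -absz_gt0 d0.
Qed.

End ElementaryDivisors.

(** * Sylvester's determinant identity *)

Section Sylvester.

Set Implicit Arguments.
Unset Strict Implicit.
Unset Printing Implicit Defensive.
Import Order.TTheory GRing.Theory Num.Theory.
Local Open Scope ring_scope.

(** Both determinants come from the block matrix [M]: column operations clear its corner [C]
    directly, row operations do so after the second block row is scaled by [x]. Nothing is divided
    by [x]. *)
Lemma det_scalar_sub_mulmx (R : comNzRingType) N P (x : R)
    (A : 'M_(N, P)) (C : 'M_(P, N)) :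
  x ^+ P * \det (x%:M - A *m C) = x ^+ N * \det (x%:M - C *m A).
Proof.
pose M := block_mx (x%:M : 'M_N) A C (1%:M : 'M_P).
have detM : \det M = \det (x%:M - A *m C).
  have : \det (M *m block_mx 1%:M 0 (- C) 1%:M) = \det (x%:M - A *m C).
    rewrite mulmx_block !mulmx1 !mulmx0 !add0r mulmxN mul1mx subrr.
    by rewrite det_ublock det1 mulr1.
  by rewrite det_mulmx det_lblock !det1 !mulr1.
rewrite -detM -det_scalar.
have -> : \det (x%:M : 'M_P) = \det (block_mx 1%:M 0 (- C) (x%:M : 'M_P)).
  by rewrite det_lblock det1 mul1r.
rewrite -det_mulmx mulmx_block !mul1mx !mul0mx !addr0 mulmx1 !mulNmx.
rewrite scalar_mxC addNr det_ublock det_scalar; congr (_ * \det _).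
by rewrite addrC.
Qed.

Lemma det_scalar_sub_const (F : fieldType) n (x y : F) :
  x != 0 -> \det (x%:M - const_mx y : 'M_n.+1) = x ^+ n * (x - n.+1%:R * y).
Proof.
move=> x0; apply: (mulfI x0).
have -> : const_mx y = (const_mx y : 'M_(n.+1, 1)) *m (const_mx 1 : 'M_(1, n.+1)).
  by apply/matrixP=> i j; rewrite !mxE big_ord1 !mxE mulr1.
rewrite -{1}[x]expr1 det_scalar_sub_mulmx exprS mulrA; congr (_ * _).
rewrite det_mx11 !mxE mulr1n; under eq_bigr do rewrite !mxE mul1r.
by rewrite sumr_const card_ord mulr_natl.
Qed.

Lemma mulmx_const_const (R : pzRingType) m n p (x y : R) :
  (const_mx x : 'M_(m, n)) *m (const_mx y : 'M_(n, p)) = const_mx (n%:R * (x * y)).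
Proof.
apply/matrixP=> i j; rewrite !mxE; under eq_bigr do rewrite !mxE.
by rewrite sumr_const card_ord mulr_natl.
Qed.

End Sylvester.

(** * Steiner systems and the determinant of L + J *)

Section SteinerSystem.

Set Implicit Arguments.
Unset Strict Implicit.
Unset Printing Implicit Defensive.
Import Order.TTheory GRing.Theory Num.Theory.
Local Open Scope ring_scope.

Lemma intrQ_nat (n : nat) : (n%:R : int)%:~R = n%:R :> rat.
Proof. exact: (rmorph_nat intr). Qed.

Local Notation toQ := (map_mx (intr : int -> rat)).

(** Rows stand for [N] blocks of size [k], columns for [P] points lying on [r] blocks each, two
    points sharing exactly one block. The relation P - 1 = r (k - 1) is written without
    subtraction. *)
Record steiner_incidence (N P k r : nat) (B : 'M[int]_(N, P)) : Prop :=
  SteinerIncidence {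
    steiner_gram : B^T *m B = (r%:R - 1)%:M + const_mx 1;
    steiner_row : forall n, B *m (const_mx 1 : 'M_(P, n)) = const_mx k%:R;
    steiner_col : forall n, B^T *m (const_mx 1 : 'M_(N, n)) = const_mx r%:R;
    steiner_points : (P + r = r * k + 1)%N;
    steiner_flags : (N * k = P * r)%N;
    steiner_k : (1 < k)%N;
    steiner_r : (1 < r)%N }.

(** For an incidence matrix, [B *m B^T] is k I plus the adjacency matrix of intersecting blocks,
    whose valency is k (r - 1). *)
Definition steiner_laplacian N P (k r : nat) (B : 'M[int]_(N, P)) : 'M[int]_N :=
  (k * r)%:R%:M - B *m B^T.

Section Spectrum.

Variables (N P k r : nat) (B : 'M[int]_(N, P)).
Hypothesis SB : steiner_incidence k r B.

Local Notation L := (steiner_laplacian k r B).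

Let k0 : (0 < k)%N. Proof. exact: ltnW (steiner_k SB). Qed.
Let r0 : (0 < r)%N. Proof. exact: ltnW (steiner_r SB). Qed.

Let points_eq (R : pzRingType) : (P%:R : R) = r%:R * k%:R + 1 - r%:R.
Proof. by apply/eqP; rewrite eq_sym subr_eq -natrM natr1 -natrD (steiner_points SB) addn1. Qed.

Lemma steiner_points_gt0 : (0 < P)%N.
Proof.
rewrite lt0n; apply/eqP => P0; have := steiner_flags SB.
have := steiner_points SB; rewrite P0 add0n => rk.
by have := leq_pmulr r k0; rewrite {1}rk addn1 ltnn.
Qed.

Lemma tr_steiner_laplacian : L^T = L.
Proof. by rewrite /steiner_laplacian linearB /= tr_scalar_mx trmx_mul trmxK. Qed.

Lemma steiner_laplacian_const n : L *m (const_mx 1 : 'M_(N, n)) = 0.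
Proof.
rewrite mulmxBl -mulmxA (steiner_col SB) mul_scalar_mx.
rewrite -[const_mx r%:R](_ : r%:R *: const_mx 1 = _); last first.
  by apply/matrixP=> i j; rewrite !mxE mulr1.
rewrite -scalemxAr (steiner_row SB) natrM.
by apply/matrixP=> i j; rewrite !mxE mulr1 mulrC subrr.
Qed.

Lemma const_steiner_laplacian n : (const_mx 1 : 'M_(n, N)) *m L = 0.
Proof.
apply: trmx_inj; rewrite trmx_mul tr_steiner_laplacian trmx_const.
by rewrite steiner_laplacian_const trmx0.
Qed.

Lemma steiner_const_sandwich : B *m const_mx 1 *m B^T = const_mx (k ^ 2)%:R.
Proof.
rewrite (steiner_row SB); apply: trmx_inj; rewrite trmx_mul trmxK !trmx_const.
have -> : const_mx k%:R = k%:R *: (const_mx 1 : 'M[int]_(P, N)).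
  by apply/matrixP=> i j; rewrite !mxE mulr1.
rewrite -scalemxAr (steiner_row SB).
by apply/matrixP=> i j; rewrite !mxE -natrM.
Qed.

(** Since B J B^T = k^2 J, the all-ones matrix also factors through [B], so L + J = k r I - B C
    where [C] has [P] rows. Sylvester's identity passes to k r I - C B = P I - (1 - r/k) J. The
    power of k r on the left avoids subtracting exponents. *)
Lemma det_steiner_laplacian :
  ((k * r) ^ P * `|(\det (L + const_mx 1))%R| = (k * r) ^ N * (P ^ P.-1 * N))%N.
Proof.
have P0 := steiner_points_gt0.
pose b := toQ B; pose mu : rat := (k * r)%:R.
have mu0 : mu != 0 by rewrite pnatr_eq0 -lt0n muln_gt0 k0.
have kQ : k%:R != 0 :> rat by rewrite pnatr_eq0 -lt0n.
pose C := (1%:M - const_mx (k%:R ^- 2)) *m b^T.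
have defLJ : toQ (L + const_mx 1) = mu%:M - b *m C.
  rewrite map_mxD map_const_mx /= mulr1z map_mxB map_scalar_mx /= map_mxM -map_trmx.
  rewrite intrQ_nat -/b /C mulmxA mulmxBr mulmx1 mulmxBl opprB addrA addrAC.
  congr (_ - _ + _).
  have -> : const_mx (k%:R ^- 2) = k%:R ^- 2 *: toQ (const_mx 1 : 'M_P).
    by apply/matrixP=> i j; rewrite !mxE mulr1z mulr1.
  rewrite -scalemxAr -scalemxAl map_trmx -!map_mxM steiner_const_sandwich.
  by apply/matrixP=> i j; rewrite !mxE /= intrQ_nat natrX mulVf ?expf_neq0.
have Cb : mu%:M - C *m b = (P%:R)%:M - const_mx (1 - r%:R / k%:R).
  rewrite /C -mulmxA map_trmx -map_mxM (steiner_gram SB) map_mxD map_const_mx.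
  rewrite map_scalar_mx /= mulr1z rmorphB /= mulr1z intrQ_nat mulmxBl mul1mx.
  rewrite mulmxDr mulmx_const_const.
  rewrite scalar_mxC mul_scalar_mx.
  apply/matrixP=> i j; rewrite !mxE points_eq /mu natrM.
  by case: (i == j); rewrite ?mulr1n ?mulr0n; field.
apply/eqP; rewrite -(eqr_nat rat) !natrM !natrX.
have PQ : P%:R != 0 :> rat by rewrite pnatr_eq0 -lt0n.
have detLJ : mu ^+ P * \det (toQ (L + const_mx 1)) = mu ^+ N * (P%:R ^+ P.-1 * N%:R).
  rewrite defLJ det_scalar_sub_mulmx Cb; congr (_ * _).
  have := det_scalar_sub_const P.-1 (1 - r%:R / k%:R) PQ; rewrite prednK // => ->.
  congr (_ * _).
  have -> : N%:R = P%:R * r%:R / k%:R :> rat.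
    by rewrite -natrM -(steiner_flags SB) natrM mulfK.
  by field.
rewrite -/mu -detLJ det_map_mx; apply/eqP; congr (_ * _).
suff d0 : 0 <= \det (L + const_mx 1).
  by rewrite -[RHS](_ : (`|(\det (L + const_mx 1))%R|%N%:Z)%:~R = _) // gez0_abs.
rewrite -(ler0z rat) -det_map_mx -(pmulr_rge0 _ (_ : 0 < mu ^+ P)).
  by rewrite detLJ !mulr_ge0 ?exprn_ge0 ?ler0n.
by rewrite exprn_gt0 // lt_def mu0 ler0n.
Qed.

End Spectrum.

End SteinerSystem.

(** * Divisibility bounds for the Steiner Laplacian *)

Section SteinerBounds.

Set Implicit Arguments.
Unset Strict Implicit.
Unset Printing Implicit Defensive.
Import Order.TTheory GRing.Theory Num.Theory.
Local Open Scope ring_scope.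

Local Notation toQ := (map_mx (intr : int -> rat)).

Lemma mxrank_sandwich (F : fieldType) m n p q (A : 'M[F]_(m, n)) (K : 'M_(n, p))
    (C : 'M_(p, q)) : (\rank (A *m K *m C) <= \rank K)%N.
Proof. exact: leq_trans (mxrankM_maxl _ _) (mxrankM_maxr _ _). Qed.

Lemma toQ_const m n : toQ (const_mx 1 : 'M_(m, n)) = const_mx 1.
Proof. by rewrite map_const_mx /= mulr1z. Qed.

Lemma dvdz_nat_mul (c m : nat) (x : int) : (c %| m)%N -> (c %| m%:R * x)%Z.
Proof. by move=> cm; rewrite natz dvdz_mulr. Qed.

Lemma dvdz_scalar_mx (c m : nat) n (x : int) (i j : 'I_n) :
  (c %| m)%N -> (c %| (m%:R * x)%:M i j)%Z.
Proof. by move=> cm; rewrite mxE; case: (_ == _) => //; apply: dvdz_nat_mul. Qed.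

Lemma dvdz_scale_mx (c m : nat) n p (A : 'M[int]_(n, p)) i j :
  (c %| m)%N -> (c %| (m%:R *: A) i j)%Z.
Proof. by move=> cm; rewrite mxE dvdz_nat_mul. Qed.

Variables (N P k r : nat) (B : 'M[int]_(N, P)).
Hypothesis SB : steiner_incidence k r B.
Variables (l : nat) (d : seq int).
Hypothesis pl : prime l.
Hypothesis smd : smith_diagonal (steiner_laplacian k r B) d.

Local Notation L := (steiner_laplacian k r B).

Let sub_points (R : pzRingType) : ((k * r)%:R - P%:R : R) = r%:R - 1.
Proof.
apply/eqP; rewrite subr_eq addrAC -natrD addnC (steiner_points SB) natrD addrK.
by rewrite mulnC.
Qed.

Let not_dvd1 : ~~ (l %| 1)%Z.
Proof. by rewrite dvdzE absz1 dvdn1 neq_ltn prime_gt1 ?orbT. Qed.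

Lemma smith_dvd_mul_kr e i :
  (l ^ e %| k * r)%N -> (P <= i < N)%N -> ((l ^ e)%N%:Z %| d`_i)%Z.
Proof.
move=> le; apply: (smith_dvd_of_rank (u := 1) (Y := - (B *m B^T)) pl smd not_dvd1).
  move=> a b; rewrite scale1r opprK addrNK -[_%:R]mulr1; exact: dvdz_scalar_mx.
by rewrite map_mxN map_mxM mxrank_opp mulmx_max_rank.
Qed.

(** On sum-zero vectors [B^T *m B] acts as r - 1, so [B] maps them to eigenvectors of [L] for k r -
    (r - 1) = P. Hence L - P I has rank at most N - (P - 1). *)
Lemma smith_dvd_points e i :
  (l ^ e %| P)%N -> (N - P.-1 <= i < N)%N -> ((l ^ e)%N%:Z %| d`_i)%Z.
Proof.
move=> le; have P0 := steiner_points_gt0 SB.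
apply: (smith_dvd_of_rank (u := 1) (Y := L - P%:R%:M) pl smd not_dvd1).
  move=> a b; rewrite scale1r opprB addrC addrNK -[_%:R]mulr1; exact: dvdz_scalar_mx.
(* The columns of [K] span the sum-zero vectors. *)
pose K : 'M[rat]_P := 1%:M - delta_mx (Ordinal P0) 0 *m (const_mx 1 : 'rV_P).
have rkK : (P.-1 <= \rank K)%N.
  have := mxrank_add K (delta_mx (Ordinal P0) 0 *m (const_mx 1 : 'rV_P)).
  rewrite subrK mxrank1 => /leq_trans/(_ (leq_add (leqnn _) (mulmx_max_rank _ _))).
  by rewrite addn1 -{1}[P]prednK.
have JK : (const_mx 1 : 'M_P) *m K = 0.
  rewrite mulmxBr mulmx1 mulmxA.
  have -> : (const_mx 1 : 'M_P) *m delta_mx (Ordinal P0) 0 = const_mx 1 :> 'cV[rat]_P.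
    by rewrite -colE; apply/matrixP=> i0 j; rewrite !mxE.
  by rewrite mulmx_const_const !mulr1 subrr.
pose b := toQ B.
have bbK : b^T *m b *m K = (r%:R - 1) *: K.
  rewrite map_trmx -map_mxM (steiner_gram SB) map_mxD toQ_const map_scalar_mx /=.
  by rewrite mulmxDl JK addr0 mul_scalar_mx rmorphB /= intrQ_nat mulr1z.
have r1 : r%:R - 1 != 0 :> rat.
  by rewrite subr_eq0 -[1]/(1%:R) eqr_nat neq_ltn (steiner_r SB) orbT.
have rkbK : (P.-1 <= \rank (b *m K))%N.
  apply: leq_trans rkK _; rewrite -(mxrank_scale_nz _ r1) -bbK -mulmxA.
  exact: mxrankM_maxr.
rewrite leq_subRL.
  apply: leq_trans (leq_add rkbK (leqnn _)) _.
  rewrite addnC; apply: mulmx0_rank_max.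
  rewrite map_mxB map_mxB map_mxM !map_scalar_mx -map_trmx -/b /= !intrQ_nat.
  rewrite addrAC -raddfB sub_points /= mulmxBl mul_scalar_mx -!mulmxA (mulmxA b^T) bbK.
  by rewrite -scalemxAr subrr.
exact: leq_trans rkbK (rank_leq_row _).
Qed.

(** Replacing P I by P I - J between [B] and [B^T] costs only k^2 J and lowers the rank by one,
    because constants are killed. Scaling [L] by [P], a unit at [l], keeps the middle matrix
    integral. *)
Lemma smith_dvd_sqr_k e i :
  ~~ (l %| P)%N -> (l ^ e %| k * r)%N -> (l ^ e %| k ^ 2)%N ->
  (P.-1 <= i < N)%N -> ((l ^ e)%N%:Z %| d`_i)%Z.
Proof.
move=> nP lkr lk2; have P0 := steiner_points_gt0 SB.
apply: (smith_dvd_of_rank (u := P%:R)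
          (Y := - (B *m (P%:R%:M - const_mx 1) *m B^T)) pl smd).
- by rewrite natz dvdzE.
- move=> a b; rewrite opprK mulmxBr mulmxBl (steiner_const_sandwich SB).
  rewrite scalerBr mul_mx_scalar -scalemxAl addrA addrNK scale_scalar_mx mulrC.
  rewrite mxE rpredD ?dvdz_scalar_mx //.
  by rewrite !mxE rpredN -[_%:R]mulr1 dvdz_nat_mul.
rewrite map_mxN mxrank_opp !map_mxM; apply: leq_trans (mxrank_sandwich _ _ _) _.
rewrite -subn1 leq_subRL // addnC.
rewrite -[X in (_ + X <= _)%N](_ : \rank (const_mx 1 : 'cV[rat]_P) = 1%N).
  apply: mulmx0_rank_max; rewrite map_mxB toQ_const map_scalar_mx /= intrQ_nat.
  rewrite mulmxBl mul_scalar_mx mulmx_const_const.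
  by apply/matrixP=> x y; rewrite !mxE !mulr1 subrr.
apply/eqP; rewrite eqn_leq rank_leq_col lt0n mxrank_eq0; apply/matrix0Pn.
by exists (Ordinal P0), 0; rewrite mxE oner_neq0.
Qed.

(** [B] sends constants to multiples of [k], so modulo [k] the constant vector can be projected away
    on both sides of the middle matrix. The cross term of the two projections carries the factor
    [P]; modulo a common divisor of [k] and [P] the rank thus drops to P - 2. *)
Lemma smith_dvd_k e i :
  (2 <= P)%N -> (l ^ e %| k)%N -> (l ^ e %| P)%N ->
  (P - 2 <= i < N)%N -> ((l ^ e)%N%:Z %| d`_i)%Z.
Proof.
move=> P2 lk lP; pose p0 : 'I_P := Ordinal (ltnW P2); pose p1 : 'I_P := Ordinal P2.
pose x : 'cV[int]_P := delta_mx p0 0; pose y : 'cV[int]_P := delta_mx p1 0.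
pose c1 : 'cV[int]_P := const_mx 1.
have dot (p q : 'I_P) : (delta_mx p 0 : 'cV[int]_P)^T *m delta_mx q 0 = (p == q)%:R%:M.
  rewrite trmx_delta mul_delta_mx_cond; apply/matrixP=> u v.
  by rewrite mulmxnE !mxE !ord1 !eqxx mulr1n.
have dot1 p : (delta_mx p 0 : 'cV[int]_P)^T *m c1 = 1%:M.
  by rewrite trmx_delta -rowE; apply/matrixP=> u v; rewrite !mxE !ord1 eqxx.
have dot1' p : c1^T *m (delta_mx p 0 : 'cV[int]_P) = 1%:M.
  by apply: trmx_inj; rewrite trmx_mul trmxK dot1 trmx1.
have c1c1 : c1^T *m c1 = P%:R%:M.
  by rewrite trmx_const mulmx_const_const; apply/matrixP=> u v; rewrite !mxE !ord1 !mulr1.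
(* The right factor has kernel spanned by [c1] and fixes [y]; the left factor has kernel spanned by
   [y]. So [K] kills both. *)
pose K : 'M[int]_P := (1%:M - y *m c1^T) *m (1%:M - c1 *m x^T).
have defK : K = 1%:M - c1 *m x^T - y *m c1^T + P%:R *: (y *m x^T).
  rewrite /K mulmxBl mul1mx mulmxBr mulmx1 opprB addrA addrAC; congr (_ + _ + _).
  by rewrite mulmxA -(mulmxA y) c1c1 mul_mx_scalar scalemxAl.
have Bc1 : B *m c1 = k%:R *: const_mx 1.
  by rewrite (steiner_row SB); apply/matrixP=> u v; rewrite !mxE mulr1.
apply: (smith_dvd_of_rank (u := 1) (Y := - (B *m K *m B^T)) pl smd not_dvd1).
  move=> a b; rewrite scale1r opprK defK.
  rewrite !mulmxDr !mulmxDl mulmx1 !mulmxN !mulNmx !mulmxA Bc1.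
  rewrite -[B *m y *m _ *m _]mulmxA -trmx_mul Bc1 linearZ /= -!scalemxAr -!scalemxAl.
  rewrite !addrA addrNK mxE rpredD ?dvdz_scale_mx // mxE rpredD //; last first.
    by rewrite mxE rpredN dvdz_scale_mx.
  rewrite mxE rpredD //; last by rewrite mxE rpredN dvdz_scale_mx.
  by rewrite -[_%:R]mulr1 dvdz_scalar_mx // dvdn_mulr.
rewrite map_mxN mxrank_opp 2!map_mxM; apply: leq_trans (mxrank_sandwich _ _ _) _.
rewrite leq_subRL // addnC.
pose Z : 'M[int]_(P, 1 + 1) := row_mx c1 y.
have KZ : K *m Z = 0.
  rewrite mul_mx_row.
  have -> : K *m c1 = 0.
    have x1 : (1%:M - c1 *m x^T) *m c1 = 0.
      by rewrite mulmxBl mul1mx -mulmxA dot1 mulmx1 subrr.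
    by rewrite /K -mulmxA x1 mulmx0.
  have -> : K *m y = 0.
    have xy : (1%:M - c1 *m x^T) *m y = y.
      by rewrite mulmxBl mul1mx -mulmxA dot mul_mx_scalar scale0r subr0.
    by rewrite /K -mulmxA xy mulmxBl mul1mx -mulmxA dot1' mulmx1 subrr.
  by rewrite row_mx0.
(* This left inverse shows that the two columns of [Z] are independent. *)
have TZ : col_mx x^T (y - x)^T *m Z = 1%:M.
  rewrite mul_col_row linearB /= !mulmxBl !dot1 !dot subrr eqxx.
  have -> : (p0 == p1) = false by [].
  by rewrite raddf0 subr0 -scalar_mx_block.
apply: leq_trans (leq_add (leqnn _) _) (mulmx0_rank_max (B := toQ Z) _).
  apply: (@mulmx1_min_rank _ 2 _ _ _ (toQ (col_mx x^T (y - x)^T)) 1%:M).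
  by rewrite mulmx1 -map_mxM TZ map_scalar_mx /= mulr1z.
by rewrite -map_mxM KZ map_mx0.
Qed.

(* On sum-zero vectors [P + B B^T] inverts [L] up to the factor [P k r], and it is
   [c^2] times a perfect pairing modulo [l] between the two families of vectors
   [w] below, based at two different points. *)
Lemma smith_dvd_mul_points e i (c : int) :
  (2 <= P)%N -> ~~ (l %| c)%Z -> (l %| P)%N -> (l ^ e %| P * (k * r))%N ->
  (forall p p0 : 'I_P, exists w : 'cV[int]_N,
      B^T *m w = c *: (delta_mx p 0 - delta_mx p0 0)) ->
  (N - P.-1 <= i < N)%N -> ((l ^ e)%N%:Z %| d`_i)%Z.
Proof.
move=> P2 lc lP lPkr exw iN.
pose p0 : 'I_P := Ordinal (ltnW P2); pose p1 : 'I_P := Ordinal P2.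
(* [pt] lists the points other than [p0] and [p1]. *)
have ptP (j : 'I_(P - 2)) : (2 + j < P)%N by rewrite -ltn_subRL.
pose pt j := Ordinal (ptP j).
have diffW (q : 'I_P) : exists W : 'M[int]_(N, P - 2),
    forall j p, (B^T *m W) p j = c * ((p == pt j)%:R - (p == q)%:R).
  have [w Bw] := fin_all_exists (fun j => exw (pt j) q).
  exists (\matrix_(a, j) w j a 0) => j p.
  have := Bw j; move/matrixP/(_ p 0); rewrite !mxE !eqxx !andbT => <-.
  by apply: eq_bigr => h _; rewrite !mxE.
(* With two different base points the columns of B^T W0 and B^T W1 pair to c^2 I, instead of c^2 (I
   + J) for a common one. *)
have [W0 BW0] := diffW p0; have [W1 BW1] := diffW p1.
have k0 : k%:R != 0 :> int by rewrite pnatr_eq0 -lt0n ltnW // (steiner_k SB).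
(* [B^T] multiplies coordinate sums by [k], and the columns of [B^T *m W] have sum 0. *)
have sum0 q (W : 'M[int]_(N, P - 2)) n :
    (forall j p, (B^T *m W) p j = c * ((p == pt j)%:R - (p == q)%:R)) ->
    (const_mx 1 : 'M_(n, N)) *m W = 0.
  move=> BW; apply/matrixP=> a j; apply: (mulfI k0); rewrite [(0 : 'M_(n, _)) a j]mxE mulr0.
  have <- : ((const_mx 1 : 'M_(n, P)) *m (B^T *m W)) a j
          = k%:R * ((const_mx 1 : 'M_(n, N)) *m W) a j.
    rewrite mulmxA -[const_mx 1 *m B^T]trmxK trmx_mul trmxK trmx_const.
    rewrite (steiner_row SB) trmx_const !mxE mulr_sumr.
    by apply: eq_bigr => h _; rewrite !mxE mul1r.
  have delta1 (x : 'I_P) : \sum_p (p == x)%:R = 1 :> int.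
    by rewrite (bigD1 x) //= eqxx big1 ?addr0 // => h /negPf ->.
  rewrite mxE; under eq_bigr do rewrite mxE BW mul1r.
  by rewrite -mulr_sumr sumrB !delta1 subrr mulr0.
have LW1 : L *m ((P%:R%:M + B *m B^T) *m W1) = (P * (k * r))%:R *: W1.
  have BBBB : B *m B^T *m (B *m B^T) = (r%:R - 1) *: (B *m B^T) + (k ^ 2)%:R *: const_mx 1.
    rewrite -mulmxA (mulmxA B^T) (steiner_gram SB) mulmxDl mulmxDr mul_scalar_mx.
    rewrite -scalemxAr mulmxA (steiner_const_sandwich SB); congr (_ + _).
    by apply/matrixP=> a b; rewrite !mxE mulr1.
  (* The terms in [B *m B^T] cancel because k r - P = r - 1. *)
  have LBB : L *m (P%:R%:M + B *m B^T)
           = (P * (k * r))%:R%:M - (k ^ 2)%:R *: const_mx 1.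
    rewrite /steiner_laplacian mulmxBl !mulmxDr BBBB !mul_scalar_mx mul_mx_scalar.
    move: (B *m B^T) => G; rewrite (natrM _ P).
    have -> : (k * r)%:R = P%:R + (r%:R - 1) :> int by rewrite -sub_points addrC subrK.
    apply/matrixP=> a b; rewrite !mxE; case: (a == b); rewrite ?mulr1n ?mulr0n; ring.
  rewrite mulmxA LBB mulmxBl mul_scalar_mx -scalemxAl (sum0 p1) //.
  by rewrite scaler0 subr0.
have W01 : (B^T *m W0)^T *m (B^T *m W1) = (c ^+ 2)%:M.
  apply/matrixP=> j h; rewrite mxE; under eq_bigr do rewrite mxE BW0 BW1.
  rewrite (bigD1 (pt j)) //= big1 ?addr0 => [|p /negPf pj].
    have -> : (pt j == pt h) = (j == h) by rewrite -!val_eqE /= eqn_add2l.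
    by rewrite eqxx mulr1 mulrA !mxE mulr_natr expr2.
  rewrite pj; have [-> | _] := eqVneq p p0; last by rewrite subrr mulr0 mul0r.
  by rewrite [p0 == pt h](_ : _ = false) // [p0 == p1](_ : _ = false) // subrr !mulr0.
pose M11 := W0^T *m ((P%:R%:M + B *m B^T) *m W1).
have defM11 : M11 = P%:R *: (W0^T *m W1) + (c ^+ 2)%:M.
  rewrite /M11 mulmxDl mul_scalar_mx mulmxDr -scalemxAr; congr (_ + _).
  by rewrite -W01 trmx_mul trmxK !mulmxA.
have ndet : ~~ (l %| \det M11)%Z.
  have pF := pchar_Fp pl.
  rewrite (dvdz_pcharf pF) -det_map_mx defM11 map_mxD map_mxZ map_scalar_mx /=.
  have -> : (P%:R : int)%:~R = 0 :> 'F_l by apply/eqP; rewrite -(dvdz_pcharf pF) natz.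
  by rewrite scale0r add0r det_scalar expf_neq0 // rmorphXn expf_neq0 //= -(dvdz_pcharf pF).
have N0 : (i < N)%N by case/andP: iN.
(* The constant vector, in the kernel of [L], is adjoined to account for the zero diagonal entry. It
   is orthogonal to the columns of [W0], so [T *m X] is block triangular. *)
pose X := row_mx ((P%:R%:M + B *m B^T) *m W1) (const_mx 1 : 'cV_N).
pose T := col_mx W0^T (delta_mx 0 (Ordinal N0) : 'rV_N).
have cP : (P - 2 + 1 = P.-1)%N by rewrite -[P in RHS](subnK P2) addn2 addn1.
apply: (@smith_dvd_of_columns l e N (P - 2 + 1) L d X T pl smd).
- move=> a b; rewrite mul_mx_row (steiner_laplacian_const SB) LW1.
  rewrite mxE; case: fintype.split => b'; last by rewrite mxE dvdz0.
  exact: dvdz_scale_mx.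
- rewrite mul_col_row.
  have -> : W0^T *m (const_mx 1 : 'cV_N) = 0.
    by apply: trmx_inj; rewrite trmx_mul trmxK trmx_const (sum0 p0) // trmx0.
  rewrite det_lblock det_mx11 -rowE !mxE mulr1; exact: ndet.
- by rewrite cP.
Qed.

End SteinerBounds.

(** * Counting points and lines of a finite vector space *)

Section Subspaces.

Set Implicit Arguments.
Unset Strict Implicit.
Unset Printing Implicit Defensive.
Import Order.TTheory GRing.Theory Num.Theory.

Lemma qintE q m : 1 < q -> qint q m * (q - 1) = q ^ m - 1.
Proof.
by move=> q1; rewrite /qint divnK // -[in X in _ %| X](exp1n m) subn_exp dvdn_mulr.
Qed.

Lemma qintS q m : 1 < q -> qint q m.+1 = q * qint q m + 1.
Proof.
move=> q1; have q0 : 0 < q - 1 by rewrite subn_gt0.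
apply/eqP; rewrite -(eqn_pmul2r q0) mulnDl -mulnA !qintE // mul1n mulnBr muln1 -expnS.
by rewrite addnBA ?(ltnW q1) // subnK // -[X in X <= _]muln1 expnS leq_pmul2l ?expn_gt0 // ltnW.
Qed.

Lemma qint0 q : qint q 0 = 0. Proof. by rewrite /qint subnn div0n. Qed.

Lemma qint1 q : 1 < q -> qint q 1 = 1.
Proof. by move=> q1; rewrite qintS // qint0 muln0. Qed.

Lemma qint2 q : 1 < q -> qint q 2 = q + 1.
Proof. by move=> q1; rewrite qintS // qint1 // muln1. Qed.

Variables (F : finFieldType) (V : vectType F).
Local Notation q := #|F|.

Lemma card_finField_gt1 : 1 < q.
Proof. exact: card_finNzRing_gt1. Qed.

Lemma sum_vspace_vectors (U : {vspace V}) :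
  \sum_(v : finvect_type V | (v : V) \in U) 1 = q ^ \dim U.
Proof.
move: U; case: V => T cT U.
by rewrite sum1_card (@card_vspace F (finvect_type (Vector.Pack cT) : finType) cT U).
Qed.

Definition subpoint (U p : {vspace V}) := (\dim p == 1) && (p <= U)%VS.

Lemma sum_nonzero_vectors (U : {vspace V}) :
  \sum_(v : finvect_type V | ((v : V) \in U) && (v != 0%R)) 1 = qint q (\dim U) * (q - 1).
Proof.
rewrite qintE ?card_finField_gt1 // -sum_vspace_vectors [in RHS](bigD1 0%R) ?mem0v //=.
by rewrite addKn.
Qed.

Lemma vline_eq (p : {vspace V}) (v : V) :
  \dim p = 1 -> (v != 0)%R -> (<[v]>%VS == p) = (v \in p).
Proof. by move=> p1 v0; rewrite eqEdim p1 dim_vline v0 andbT. Qed.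

(** Each nonzero vector of [U] spans one point, and each point arises from q - 1 of them. *)
Lemma sum_subpoints (U : {vspace V}) :
  \sum_(p | subpoint U p) 1 = qint q (\dim U).
Proof.
have q1 := card_finField_gt1; apply/eqP; rewrite -(@eqn_pmul2r (q - 1)) ?subn_gt0 //.
rewrite -sum_nonzero_vectors.
rewrite (partition_big (fun v : finvect_type V => <[v : V]>%VS) (subpoint U)) /=; last first.
  by move=> v /andP[vU v0]; rewrite /subpoint dim_vline v0.
rewrite big_distrl /=; apply/eqP; apply: eq_bigr => p /andP[/eqP p1 pU].
rewrite mul1n -[q - 1]mul1n -[X in X * _](qint1 q1) -[X in qint q X]p1.
rewrite -sum_nonzero_vectors; apply: eq_bigl => v.
have [v0|v0] := eqVneq v 0%R; first by rewrite !andbF.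
by rewrite !andbT vline_eq // andb_idl // => /(subvP pU).
Qed.

Lemma dim_point_cap (p p' : {vspace V}) :
  \dim p = 1 -> \dim p' = 1 -> p != p' -> (p :&: p' = 0)%VS.
Proof.
move=> p1 p1' pp'; apply/eqP; rewrite -dimv_eq0 -leqn0 -ltnS.
have := dimv_leqif_eq (capvSl p p'); rewrite p1 => -[]; rewrite leq_eqVlt.
case/orP=> // /eqP-> /esym; rewrite eqxx => /eqP cap.
case/eqP: pp'; apply/eqP; rewrite eqEdim p1 p1' andbT.
by rewrite -cap capvSr.
Qed.

Lemma dim_point_add (p p' : {vspace V}) :
  \dim p = 1 -> \dim p' = 1 -> p != p' -> \dim (p + p')%VS = 2.
Proof. by move=> p1 p1' pp'; rewrite dimv_disjoint_sum ?dim_point_cap // p1 p1'. Qed.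

Lemma line_through (p p' l : {vspace V}) :
  \dim p = 1 -> \dim p' = 1 -> p != p' ->
  [&& \dim l == 2, (p <= l)%VS & (p' <= l)%VS] = (l == (p + p')%VS).
Proof.
move=> p1 p1' pp'; rewrite -subv_add [RHS]eq_sym eqEdim dim_point_add //.
rewrite andbC; case pl : (_ <= l)%VS => //=.
have l2 : 2 <= \dim l by rewrite -(dim_point_add p1 p1' pp') dimvS.
by rewrite eqn_leq l2 andbT.
Qed.

Lemma sum_lines_through2 (W p p' : {vspace V}) :
  \dim p = 1 -> \dim p' = 1 -> p != p' ->
  \sum_(l | (\dim l == 2) && (l <= W)%VS) ((p <= l)%VS && (p' <= l)%VS)
  = (p <= W)%VS && (p' <= W)%VS.
Proof.
move=> p1 p1' pp'.
have -> : \sum_(l | (\dim l == 2) && (l <= W)%VS) ((p <= l)%VS && (p' <= l)%VS)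
        = \sum_(l | (l == (p + p')%VS) && (l <= W)%VS) 1.
  rewrite big_mkcond [RHS]big_mkcond; apply: eq_bigr => l _.
  by rewrite -line_through //; do !case: (_ <= _)%VS; case: (_ == _).
rewrite -subv_add; case pW : (_ <= W)%VS.
  by rewrite (big_pred1 (p + p')%VS) // => l /=; case: eqP => // ->.
by rewrite big_pred0 // => l; case: eqP => // ->.
Qed.

(** Points of [W] other than [p] are grouped by their join with [p]. Every line through [p] carries
    q further points, so q times the number of lines, plus 1, is [m + 1]. *)
Lemma sum_lines_through (W p : {vspace V}) m :
  \dim p = 1 -> (p <= W)%VS -> \dim W = m.+1 ->
  \sum_(l | (\dim l == 2) && (l <= W)%VS) (p <= l)%VS = qint q m.
Proof.
move=> p1 pW dW; have q1 := card_finField_gt1; apply/eqP.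
rewrite -(@eqn_pmul2r q) ?(ltnW q1) // -(eqn_add2r 1) [X in _ == X + _]mulnC -qintS //.
rewrite -dW -sum_subpoints [X in _ == X](bigD1 p) /=; last by rewrite /subpoint p1 eqxx.
rewrite addnC eqn_add2l.
rewrite [X in _ == X](partition_big (fun p' => (p + p')%VS)
  (fun l => [&& \dim l == 2, (l <= W)%VS & (p <= l)%VS])) /=; last first.
  move=> p' /andP[/andP[/eqP p1' pW'] pp']; rewrite eq_sym in pp'.
  by rewrite dim_point_add // subv_add pW pW' addvSl.
rewrite big_distrl /= big_mkcond [X in _ == X]big_mkcond; apply/eqP.
apply: eq_bigr => l _; case: eqP => //= dl; case lW : (l <= W)%VS => //=.
case pl : (p <= l)%VS; rewrite ?mul0n // mul1n; apply/eqP; rewrite -(eqn_add2r 1).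
rewrite -qint2 // -dl -sum_subpoints [X in X == _](bigD1 p) /=; last first.
  by rewrite /subpoint p1 eqxx.
rewrite addnC eqn_add2r; apply/eqP/eq_bigl => p'; rewrite /subpoint.
have [p1'|] := eqVneq (\dim p') 1 => //=; have [//|pp'] := eqVneq p' p; rewrite ?andbF //.
rewrite !andbT [RHS]andbC [X in _ = X && _]eq_sym -line_through 1?eq_sym //.
rewrite dl pl eqxx /= andb_idr // => pl'.
exact: subv_trans lW.
Qed.

Lemma vspace_extend (U : {vspace V}) m :
  \dim U <= m <= \dim {:V} -> exists2 W : {vspace V}, (U <= W)%VS & \dim W = m.
Proof.
elim: m => [|m IH] /andP[Um mV].
  by exists U => //; apply/eqP; rewrite -leqn0.
have [eU|nU] := eqVneq (\dim U) m.+1; first by exists U.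
have [|W UW dW] := IH; first by rewrite -ltnS ltn_neqAle nU Um ltnW.
have /subvPn[v _ vW] : ~~ ({:V} <= W)%VS.
  by apply/negP => /dimvS; rewrite dW leqNgt mV.
exists (W + <[v]>)%VS; first exact: subv_trans UW (addvSl _ _).
have v0 : v != 0%R by apply: contraNneq vW => ->; rewrite mem0v.
rewrite dimv_disjoint_sum ?dW ?dim_vline ?v0 ?addn1 //.
apply/eqP; rewrite -subv0; apply/subvP => x /memv_capP[xW /vlineP[c cx]].
rewrite memv0; move: xW; rewrite cx rpredZeq (negPf vW) orbF => /eqP->.
by rewrite scale0r.
Qed.

End Subspaces.

(** * The point-line incidence matrix and the Grassmann graph *)

Section GrassmannIncidence.

Set Implicit Arguments.
Unset Strict Implicit.
Unset Printing Implicit Defensive.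
Import Order.TTheory GRing.Theory Num.Theory.

Lemma sum_enum_val (T : finType) (G : T -> nat) :
  \sum_(i < #|T|) G (enum_val i) = \sum_x G x.
Proof. by rewrite [RHS](reindex (@enum_val T T)) //; apply/onW_bij/enum_val_bij. Qed.

Lemma sum_sig (T : finType) (Q : pred T) (G : T -> nat) :
  \sum_(x : {x | Q x}) G (val x) = \sum_(x | Q x) G x.
Proof.
rewrite [RHS](@reindex_omap _ _ _ _ {x | Q x} val insub) => [|x Qx]; last by rewrite insubT.
by apply: eq_bigl => x; rewrite valK eqxx (valP x).
Qed.

Variables (F : finFieldType) (V : vectType F).
Local Notation q := #|F|.

Definition vpoint : finType := {p : {vspace V} | \dim p == 1}.

Definition incidence_mx : 'M[int]_(#|grassmann_vertex V|, #|vpoint|) :=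
  (\matrix_(i, j) ((val (enum_val j : vpoint) <=
                    val (enum_val i : grassmann_vertex V))%VS : nat)%:R)%R.

Lemma sum_points (G : {vspace V} -> nat) :
  \sum_(j < #|vpoint|) G (val (enum_val j : vpoint)) = \sum_(p | \dim p == 1) G p.
Proof. by rewrite (sum_enum_val (fun x : vpoint => G (val x))) sum_sig. Qed.

Lemma sum_lines (G : {vspace V} -> nat) :
  \sum_(i < #|grassmann_vertex V|) G (val (enum_val i : grassmann_vertex V))
  = \sum_(l | \dim l == 2) G l.
Proof. by rewrite (sum_enum_val (fun x : grassmann_vertex V => G (val x))) sum_sig. Qed.

Lemma sum_subpoints_nat (U : {vspace V}) :
  \sum_(p | \dim p == 1) (p <= U)%VS = qint q (\dim U).
Proof.
rewrite -sum_subpoints [RHS]big_mkcondr; apply: eq_bigr => p _.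
by case: (_ <= _)%VS.
Qed.

Lemma card_vpoint : #|vpoint| = qint q (\dim {:V}).
Proof.
rewrite -sum_subpoints_nat -sum_points -[LHS]card_ord -sum1_card.
by apply: eq_bigr => j _; rewrite subvf.
Qed.

Let dim_pt (j : 'I_#|vpoint|) : \dim (val (enum_val j : vpoint)) = 1.
Proof. exact/eqP/(valP (enum_val j)). Qed.

Let dim_ln (i : 'I_#|grassmann_vertex V|) :
  \dim (val (enum_val i : grassmann_vertex V)) = 2.
Proof. exact/eqP/(valP (enum_val i)). Qed.

Let val_pt_inj (j j' : 'I_#|vpoint|) :
  (val (enum_val j : vpoint) == val (enum_val j' : vpoint)) = (j == j').
Proof. by rewrite val_eqE (inj_eq enum_val_inj). Qed.

Lemma sum_lines_in_space (p : {vspace V}) m :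
  \dim p = 1 -> \dim {:V} = m.+1 ->
  \sum_(l | \dim l == 2) (p <= l)%VS = qint q m.
Proof.
move=> p1 dV; rewrite -(sum_lines_through p1 (subvf p) dV).
by apply: eq_bigl => l; rewrite subvf andbT.
Qed.

Lemma incidence_mxM_const n :
  (incidence_mx *m (const_mx 1 : 'M_(_, n)) = const_mx (q + 1)%N%:R)%R.
Proof.
apply/matrixP=> i j; rewrite !mxE -qint2 ?card_finField_gt1 // -(dim_ln i).
rewrite -sum_subpoints_nat -sum_points natr_sum.
by apply: eq_bigr => h _; rewrite !mxE mulr1.
Qed.

Lemma tr_incidence_mxM_const n m : \dim {:V} = m.+1 ->
  (incidence_mx^T *m (const_mx 1 : 'M_(_, n)) = const_mx (qint q m)%:R)%R.
Proof.
move=> dV; apply/matrixP=> j h; rewrite !mxE -(sum_lines_in_space (dim_pt j) dV).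
rewrite -sum_lines natr_sum.
by apply: eq_bigr => i _; rewrite !mxE mulr1.
Qed.

Lemma incidence_gram m : \dim {:V} = m.+1 ->
  (incidence_mx^T *m incidence_mx = ((qint q m)%:R - 1)%:M + const_mx 1)%R.
Proof.
move=> dV; apply/matrixP=> j j'; rewrite !mxE.
pose p := val (enum_val j : vpoint); pose p' := val (enum_val j' : vpoint).
have -> : (\sum_i incidence_mx^T j i * incidence_mx i j')%R
        = (\sum_(l | \dim l == 2) ((p <= l)%VS && (p' <= l)%VS))%:R%R.
  rewrite -sum_lines natr_sum; apply: eq_bigr => i _.
  by rewrite !mxE -natrM mulnb.
have [jj | nj] := eqVneq j j'.
  rewrite mulr1n subrK /p' -jj -(sum_lines_in_space (dim_pt j) dV).
  by under eq_bigr do rewrite andbb.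
rewrite mulr0n add0r.
have := @sum_lines_through2 F V fullv p p' (dim_pt j) (dim_pt j').
rewrite val_pt_inj => /(_ nj); rewrite !subvf => sum1.
rewrite -[RHS]/((true && true : nat)%:R)%R -sum1.
by congr (_%:R)%R; apply: eq_bigl => l; rewrite subvf andbT.
Qed.

Lemma sum_incidences m : \dim {:V} = m.+1 ->
  #|grassmann_vertex V| * (q + 1) = #|vpoint| * qint q m.
Proof.
move=> dV; transitivity (\sum_(l : {vspace V} | \dim l == 2) \sum_(p : {vspace V} | \dim p == 1) (p <= l)%VS).
  rewrite -sum_lines -[in LHS](card_ord #|grassmann_vertex V|) -sum_nat_const.
  by apply: eq_bigr => i _; rewrite sum_subpoints_nat dim_ln qint2 ?card_finField_gt1.
rewrite exchange_big /= -sum_points -[in RHS](card_ord #|vpoint|) -sum_nat_const.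
by apply: eq_bigr => j _; rewrite (sum_lines_in_space (dim_pt j) dV).
Qed.

Lemma qint_gt1 m : 1 < qint q m.+2.
Proof.
have q1 := card_finField_gt1 F; rewrite !qintS // addn1 ltnS muln_gt0 addn1 andbT.
exact: ltnW.
Qed.

Lemma incidence_steiner m : \dim {:V} = m.+3 ->
  steiner_incidence (q + 1) (qint q m.+2) incidence_mx.
Proof.
move=> dV; split.
- exact: incidence_gram.
- exact: incidence_mxM_const.
- by move=> n; apply: tr_incidence_mxM_const.
- rewrite card_vpoint dV qintS ?card_finField_gt1 //.
  by rewrite mulnDr muln1 mulnC addnAC.
- exact: sum_incidences.
- by rewrite addn1 ltnS ltnW // card_finField_gt1.
- exact: qint_gt1.
Qed.

(** In a 3-dimensional [W] containing both points, the lines of [W] through [p] cover every point of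
    [W] once, except [p] itself, which is covered q + 1 times. So [B^T] maps this pencil to the
    indicator of [W] plus q times [p], and the indicator cancels in a difference of two pencils. *)
Lemma incidence_pencil_difference m (p p0 : 'I_#|vpoint|) : \dim {:V} = m.+3 ->
  exists w : 'cV[int]_#|grassmann_vertex V|,
    (incidence_mx^T *m w = q%:R *: (delta_mx p 0 - delta_mx p0 0))%R.
Proof.
move=> dV.
have [<- | np] := eqVneq p p0; first by exists 0%R; rewrite mulmx0 subrr scaler0.
pose sp (j : 'I_#|vpoint|) := val (enum_val j : vpoint).
have dpp : \dim (sp p + sp p0)%VS = 2 by rewrite dim_point_add ?dim_pt // val_pt_inj.
have [|W ppW dW] := @vspace_extend F V (sp p + sp p0)%VS 3; first by rewrite dpp dV.
rewrite subv_add in ppW; case/andP: ppW => pW p0W.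
pose pencil (j : 'I_#|vpoint|) : 'cV[int]_#|grassmann_vertex V| :=
  (\col_i (((val (enum_val i : grassmann_vertex V) <= W)%VS
           && (sp j <= val (enum_val i : grassmann_vertex V))%VS : nat)%:R))%R.
have inc_pencil j h : (sp j <= W)%VS ->
    ((incidence_mx^T *m pencil j) h 0 = (sp h <= W)%VS%:R + (q * (h == j))%N%:R)%R.
  move=> jW; rewrite mxE.
  have -> : (\sum_i incidence_mx^T h i * pencil j i 0)%R
      = (\sum_(l | (\dim l == 2) && (l <= W)%VS) ((sp h <= l)%VS && (sp j <= l)%VS))%:R%R.
    rewrite big_mkcondr -sum_lines natr_sum; apply: eq_bigr => i _.
    by rewrite !mxE -natrM; do !case: (_ <= _)%VS.
  rewrite -natrD; congr (_%:R)%R; have [-> | nh] := eqVneq h j.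
    rewrite jW muln1 addnC -qint2 ?card_finField_gt1 //.
    rewrite -[RHS](sum_lines_through (dim_pt j) jW dW).
    by under eq_bigr do rewrite andbb.
  by rewrite muln0 addn0 sum_lines_through2 ?dim_pt ?val_pt_inj // jW andbT.
exists (pencil p - pencil p0)%R; rewrite mulmxBr.
apply/matrixP=> h z; rewrite (ord1 z).
transitivity ((incidence_mx^T *m pencil p) h 0 - (incidence_mx^T *m pencil p0) h 0)%R.
  by rewrite !mxE.
rewrite !inc_pencil // !mxE !eqxx !andbT !natrM mulrBr opprD addrACA subrr add0r.
by [].
Qed.

(** The entry counts the points common to two lines, which is 0, 1 or q + 1 according to the
    dimension of the intersection. *)
Lemma incidence_mxM_tr (i i' : 'I_#|grassmann_vertex V|) :
  ((incidence_mx *m incidence_mx^T) i i' =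
   (@grassmann_adj F V (enum_val i) (enum_val i') + (q + 1) * (i == i'))%N%:R)%R.
Proof.
have q1 := card_finField_gt1 F; rewrite mxE.
pose U := val (enum_val i : grassmann_vertex V).
pose U' := val (enum_val i' : grassmann_vertex V).
have -> : (\sum_j incidence_mx i j * incidence_mx^T j i')%R
        = (qint q (\dim (U :&: U')%VS))%:R%R.
  rewrite -sum_subpoints_nat -sum_points natr_sum; apply: eq_bigr => j _.
  by rewrite !mxE -natrM mulnb subv_cap.
congr (_%:R)%R; rewrite /grassmann_adj (inj_eq enum_val_inj) -/U -/U'.
have [ii | ni] := eqVneq i i'.
  by rewrite /U' -ii capvv dim_ln qint2 // muln1.
rewrite muln0 addn0 /= -dimv_eq0.
have nU : U != U' by rewrite val_eqE (inj_eq enum_val_inj).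
have : \dim (U :&: U')%VS < 2.
  have := dimv_leqif_eq (capvSl U U'); rewrite dim_ln => -[].
  rewrite leq_eqVlt; case/orP=> // /eqP-> /esym; rewrite eqxx => /eqP cU.
  case/eqP: nU; apply/eqP; rewrite eqEdim !dim_ln andbT.
  by rewrite -cU capvSr.
by case: (\dim _) => [|[|]] //; rewrite ?qint0 ?qint1.
Qed.

Lemma grassmann_degree m (U : grassmann_vertex V) : \dim {:V} = m.+3 ->
  #|[set W | @grassmann_adj F V U W]| + (q + 1) = (q + 1) * qint q m.+2.
Proof.
move=> dV; rewrite cardsE -sum1_card big_mkcond /=.
rewrite -(sum_enum_val (fun W => if W \in @grassmann_adj F V U then 1 else 0)).
rewrite -[U]enum_rankK; set i := enum_rank U.
have sumk : \sum_j (q + 1) * (i == j) = q + 1.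
  rewrite (bigD1 i) //= eqxx muln1 big1 ?addn0 // => j /negPf.
  by rewrite eq_sym => ->; rewrite muln0.
rewrite -[X in _ + X = _]sumk -big_split /=; apply/eqP; rewrite -(eqr_nat int) natr_sum; apply/eqP.
transitivity ((incidence_mx *m incidence_mx^T *m (const_mx 1 : 'cV_#|grassmann_vertex V|)) i 0)%R.
  rewrite mxE; apply: eq_bigr => j _; rewrite incidence_mxM_tr mxE mulr1.
  by congr (_%:R)%R; congr (_ + _); rewrite -[_ \in _]/(grassmann_adj _ _); case: grassmann_adj.
rewrite -mulmxA (tr_incidence_mxM_const _ dV).
have -> : (const_mx (qint q m.+2)%:R = (qint q m.+2)%:R *: const_mx 1 :> 'cV[int]_#|vpoint|)%R.
  by apply/matrixP=> a b; rewrite !mxE mulr1.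
by rewrite -scalemxAr incidence_mxM_const !mxE natrM mulrC.
Qed.

Lemma grassmann_laplacian_steiner m : \dim {:V} = m.+3 ->
  grassmann_laplacian V = steiner_laplacian (q + 1) (qint q m.+2) incidence_mx.
Proof.
move=> dV.
(* The valency is a maximum over vertices, so some vertex must be exhibited to attain it. *)
have [|U0 _ dU0] := @vspace_extend F V 0%VS 2; first by rewrite dimv0 dV.
pose u0 : grassmann_vertex V := Sub U0 (introT eqP dU0).
have val_k : valency (@grassmann_adj F V) + (q + 1) = (q + 1) * qint q m.+2.
  rewrite -(grassmann_degree u0 dV); congr (_ + _).
  apply/eqP; rewrite eqn_leq; apply/andP; split; last first.
    exact: (@leq_bigmax _ (fun x => #|[set y | @grassmann_adj F V x y]|) u0).
  apply/bigmax_leqP => U _; rewrite -(leq_add2r (q + 1)).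
  by rewrite !(grassmann_degree _ dV).
rewrite /steiner_laplacian -val_k.
apply/matrixP=> i j; rewrite /grassmann_laplacian /laplacian_mx.
rewrite [RHS]mxE [X in _ = (_ + X)%R]mxE incidence_mxM_tr !mxE !natrD natrM.
by case: (i == j); rewrite /= ?mulr1n ?mulr0n; ring.
Qed.

End GrassmannIncidence.

(** * Elementary divisor multiplicities of the Steiner Laplacian *)

Section SteinerElementaryDivisors.

Set Implicit Arguments.
Unset Strict Implicit.
Unset Printing Implicit Defensive.
Import Order.TTheory GRing.Theory Num.Theory.

Lemma logn_not_dvd l m : ~~ (l %| m) -> logn l m = 0.
Proof. by move=> lm; rewrite lognE (negPf lm) !andbF. Qed.

Variables (N P k r : nat) (B : 'M[int]_(N, P)).
Hypothesis SB : steiner_incidence k r B.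
Variables (l : nat) (d : seq int).
Hypothesis pl : prime l.
Hypothesis smd : smith_diagonal (steiner_laplacian k r B) d.
Hypothesis P_gt1 : 1 < P.
Hypothesis P_lt_N : P < N.

Let N_eq : N = N.-1.+1. Proof. by rewrite prednK // (leq_trans _ P_lt_N). Qed.

(** The product of the nonzero entries is, up to sign, (k r)^(N - P) P^(P - 1) / N, and N k = P r
    eliminates the valuation of [N]. *)
Lemma steiner_nonzero_part :
  [/\ size d = N, (d`_N.-1 = 0)%R, (\prod_(i < N.-1) d`_i != 0)%R &
      logn l `|(\prod_(i < N.-1) d`_i)%R| =
      (P - 2) * logn l P + 2 * logn l k + (N - P - 1) * (logn l k + logn l r)].
Proof.
have k0 := ltnW (steiner_k SB); have r0 := ltnW (steiner_r SB).
have N0 : 0 < N by apply: leq_trans P_lt_N.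
have P0 : 0 < P := ltnW P_gt1.
have detE := det_steiner_laplacian SB.
have flags := congr1 (logn l) (steiner_flags SB).
have : (d`_N.-1 = 0)%R /\ `|(\prod_(i < N.-1) d`_i)%R| * N ^ 2 =
    `|(\det (steiner_laplacian k r B + const_mx 1))%R|.
  have det0 : (\det (steiner_laplacian k r B + const_mx 1) != 0)%R.
    rewrite -absz_gt0; have : 0 < (k * r) ^ N * (P ^ P.-1 * N).
      by rewrite !muln_gt0 !expn_gt0 !muln_gt0 k0 r0 P0 N0.
    by rewrite -detE muln_gt0 => /andP[].
  have := steiner_laplacian_const SB 1; have := const_steiner_laplacian SB 1.
  move: smd det0; move: (steiner_laplacian k r B) => M; clear -N_eq.
  case: N N_eq M => // n _ M smdM det0 M1 M1l.
  exact: smith_laplacian.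
case=> dN detD.
have Dgt0 : 0 < `|(\prod_(i < N.-1) d`_i)%R|.
  have : 0 < (k * r) ^ N * (P ^ P.-1 * N).
    by rewrite !muln_gt0 !expn_gt0 !muln_gt0 k0 r0 P0 N0.
  by rewrite -detE -detD !muln_gt0 => /and3P[].
split=> //.
- by case: smd => ->; rewrite minnn.
- by rewrite -absz_gt0.
have := congr1 (logn l) detE; rewrite -detD.
rewrite !lognM ?muln_gt0 ?expn_gt0 ?muln_gt0 ?k0 ?r0 ?P0 ?N0 ?Dgt0 //.
rewrite !lognX !lognM //; move: flags; rewrite !lognM //.
move: (logn l _) (logn l _) (logn l _) (logn l _) (logn l _) => vD.
move: (logn l N) (logn l k) (logn l P) (logn l r) => vN vk vP vr h1 h2.
(* Naming N - P - 1 and P - 2 removes the truncated subtractions before the nonlinear arithmetic. *)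
have [s Ns] : exists s, N = P + s.+1 by exists (N - P.+1); lia.
have [t Pt] : exists t, P = t.+2 by exists (P - 2); lia.
have -> : N - P - 1 = s by lia.
have -> : P - 2 = t by lia.
move: h2; rewrite Ns Pt /=; nia.
Qed.

(** The counts add up to [N.-1] since the zero entry is left out; the total valuation makes both
    bounds sharp. *)
Lemma steiner_elemdiv n0 n1 n2 e1 e2 :
  n0 + n1 + n2 = N.-1 ->
  (forall i, n0 <= i < N -> ((l ^ e1)%N%:Z %| (d`_i)%R)%Z) ->
  (forall i, n0 + n1 <= i < N -> ((l ^ e2)%N%:Z %| (d`_i)%R)%Z) ->
  n1 * e1 + n2 * e2 =
    (P - 2) * logn l P + 2 * logn l k + (N - P - 1) * (logn l k + logn l r) ->
  forall j, elemdiv_mult l d j = (0 == j) * n0 + (e1 == j) * n1 + (e2 == j) * n2.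
Proof.
move=> sz b1 b2 tot j; have [szd dN D0 vD] := steiner_nonzero_part.
pose s := nseq n0 0 ++ nseq n1 e1 ++ nseq n2 e2.
rewrite (@elemdiv_mult_of_bounds l N.-1 d s) //.
- by rewrite !count_cat !count_nseq /= addnA.
- by rewrite szd -N_eq.
- by rewrite !size_cat !size_nseq addnA.
- move=> i iN; have iN' : i < N by rewrite N_eq ltnS ltnW.
  rewrite nth_cat size_nseq; case: ltnP => i0; first by rewrite nth_nseq i0 expn0 dvd1z.
  rewrite nth_cat size_nseq ltn_subLR //; case: ltnP => i1.
    by rewrite nth_nseq ltn_subLR // i1 b1 // i0.
  have -> : nth 0 (nseq n2 e2) (i - n0 - n1) = e2.
    by rewrite nth_nseq -subnDA ltn_subLR // sz iN.
  by rewrite b2 // i1.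
- by rewrite vD -tot !sumn_cat !sumn_nseq mul0n add0n mulnC [e2 * _]mulnC.
Qed.

Lemma steiner_critical_group_order :
  has_order (critical_group (steiner_laplacian k r B)) `|(\prod_(i < N.-1) d`_i)%R|.
Proof.
have [szd dN D0 _] := steiner_nonzero_part.
suff -> : `|(\prod_(i < N.-1) d`_i)%R| = \prod_(x <- d | (x != 0)%R) `|x|.
  exact: critical_group_order.
move: (N) N_eq szd dN D0 => [|n] // _ szd dN D0.
rewrite (big_nth 0%R) szd absz_prod big_mkord [RHS]big_mkcond big_ord_recr /= dN eqxx muln1; apply: eq_bigr => i _.
case: eqP => // di; move: D0; rewrite (bigD1 i) //= di mul0r eqxx.
by [].
Qed.

Let logn_kr : logn l (k * r) = logn l k + logn l r.
Proof. by rewrite lognM // ltnW // ?(steiner_k SB) ?(steiner_r SB). Qed.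

Let dvd_kr e : e <= logn l k + logn l r -> l ^ e %| k * r.
Proof. by rewrite -logn_kr => /(dvdn_exp2l l)/dvdn_trans; apply; apply: pfactor_dvdnn. Qed.

Lemma steiner_critical_group_coprime :
  ~~ (l %| k) -> ~~ (l %| P) -> ~~ (l %| r) ->
  exists2 M, has_order (critical_group (steiner_laplacian k r B)) M & ~~ (l %| M).
Proof.
move=> lk lP lr; have [_ _ D0] := steiner_nonzero_part.
rewrite (logn_not_dvd lk) (logn_not_dvd lP) (logn_not_dvd lr) !muln0 => vD.
exists `|(\prod_(i < N.-1) d`_i)%R|; first exact: steiner_critical_group_order.
move: vD; rewrite lognE pl absz_gt0 D0 /=.
by case: (_ %| _).
Qed.

Lemma steiner_elemdiv_points :
  ~~ (l %| k) -> ~~ (l %| r) -> forall j,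
  elemdiv_mult l d j = (0 == j) * (N - P + 1) + (logn l P == j) * (P - 2).
Proof.
move=> lk lr j; rewrite (@steiner_elemdiv (N - P + 1) 0 (P - 2) 0 (logn l P)).
- by rewrite muln0 addn0.
- by move: P_gt1 P_lt_N; lia.
- by move=> i _; rewrite expn0 dvd1z.
- move=> i iN; apply: (smith_dvd_points SB pl smd); first exact: pfactor_dvdnn.
  by move: iN P_gt1 P_lt_N; lia.
- by rewrite (logn_not_dvd lk) (logn_not_dvd lr) !muln0 !addn0.
Qed.

Lemma steiner_elemdiv_replication :
  ~~ (l %| k) -> ~~ (l %| P) -> forall j,
  elemdiv_mult l d j = (0 == j) * P + (logn l r == j) * (N - P - 1).
Proof.
move=> lk lP j; rewrite (@steiner_elemdiv P 0 (N - P - 1) 0 (logn l r)).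
- by rewrite muln0 addn0.
- by move: P_gt1 P_lt_N; lia.
- by move=> i _; rewrite expn0 dvd1z.
- move=> i iN; apply: (smith_dvd_mul_kr (B := B) pl smd); last by rewrite -[P]addn0.
  by rewrite dvd_kr // leq_addl.
- by rewrite (logn_not_dvd lk) (logn_not_dvd lP) !muln0 !add0n.
Qed.

(** The congruence modulo k r handles the indices from [P] on; the one using k^2 gains the single
    index P - 1. The inequality of valuations makes l^(2 v(k)) divide k r. *)
Lemma steiner_elemdiv_not_dvd_points :
  ~~ (l %| P) -> logn l k <= logn l r -> forall j,
  elemdiv_mult l d j = (0 == j) * (P - 1) + (2 * logn l k == j) * 1
                       + (logn l k + logn l r == j) * (N - P - 1).
Proof.
move=> lP kr; apply: steiner_elemdiv.
- by move: P_gt1 P_lt_N; lia.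
- move=> i iN; apply: (smith_dvd_sqr_k SB pl smd) => //; last by rewrite -subn1.
  + by rewrite dvd_kr // mul2n -addnn leq_add2l.
  + by rewrite mulnC expnM dvdn_exp2r // pfactor_dvdnn.
- move=> i iN; apply: (smith_dvd_mul_kr (B := B) pl smd); first exact: dvd_kr.
  by rewrite subnK // ltnW in iN.
- by rewrite (logn_not_dvd lP) muln0 mul1n.
Qed.

(** From index P - 2 on, the entries are divisible by the [l]-part of [k]; the last P - 1, including
    the zero entry, by that of P k. The first inequality keeps the middle count from being
    truncated. *)
Lemma steiner_elemdiv_dvd_points (c : int) :
  2 * P <= N + 3 -> l %| P -> ~~ (l %| r) -> logn l k <= logn l P ->
  ~~ (l %| c)%Z ->
  (forall p p0 : 'I_P, exists w : 'cV[int]_N,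
      B^T *m w = c *: (delta_mx p 0 - delta_mx p0 0))%R -> forall j,
  elemdiv_mult l d j = (0 == j) * (P - 2) + (logn l k == j) * (N + 3 - 2 * P)
                       + (logn l k + logn l P == j) * (P - 2).
Proof.
move=> PN lP lr kP lc exw; have vr := logn_not_dvd lr.
have middle : P - 2 + (N + 3 - 2 * P) = N - P.-1.
  by clear -P_gt1 P_lt_N PN; lia.
have total : N + 3 - 2 * P + (P - 2) = N - P - 1 + 2.
  by clear -P_gt1 P_lt_N PN; lia.
apply: steiner_elemdiv.
- by rewrite middle; clear -P_gt1 P_lt_N; lia.
- move=> i iN; apply: (smith_dvd_k SB pl smd) => //; first exact: pfactor_dvdnn.
  exact: dvdn_trans (dvdn_exp2l l kP) (pfactor_dvdnn _ _).
- rewrite middle => i iN; apply: (smith_dvd_mul_points SB pl smd P_gt1 lc lP _ exw iN).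
  rewrite expnD mulnC dvdn_mul ?pfactor_dvdnn //.
  by rewrite dvdn_mulr // pfactor_dvdnn.
- by rewrite vr addn0 mulnDr addnA -mulnDl total mulnDl addnC [in RHS]addnAC -addnA.
Qed.

End SteinerElementaryDivisors.

Lemma mult_are2 (e : nat -> nat) x n0 n1 :
  (forall j, e j = (0 == j) * n0 + (x == j) * n1) -> 0 < x ->
  mult_are e [:: (x, n1); (0, n0)].
Proof.
move=> eE x0; split=> [c | i].
  rewrite !inE => /orP[] /eqP-> /=; rewrite eE ?eqxx ?mul1n.
    by rewrite (ltn_eqF x0).
  by rewrite (gtn_eqF x0) addn0.
rewrite !inE /= negb_or => /andP[ix i0].
by rewrite eE eq_sym (negPf i0) eq_sym (negPf ix).
Qed.

Lemma mult_are3 (e : nat -> nat) x y n0 n1 n2 :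
  (forall j, e j = (0 == j) * n0 + (x == j) * n1 + (y == j) * n2) -> 0 < x -> x < y ->
  mult_are e [:: (y, n2); (x, n1); (0, n0)].
Proof.
move=> eE x0 xy; have y0 := ltn_trans x0 xy; split=> [c | i].
  rewrite !inE => /or3P[] /eqP-> /=; rewrite eE ?eqxx ?mul1n.
  - by rewrite (ltn_eqF y0) (ltn_eqF xy).
  - by rewrite (ltn_eqF x0) (gtn_eqF xy) addn0.
  - by rewrite (gtn_eqF x0) (gtn_eqF y0) !addn0.
rewrite !inE /= !negb_or => /and3P[iy ix i0].
by rewrite eE eq_sym (negPf i0) eq_sym (negPf ix) eq_sym (negPf iy).
Qed.

(** * Numerical facts about the Grassmann graph *)

Section GrassmannCounts.

Set Implicit Arguments.
Unset Strict Implicit.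
Unset Printing Implicit Defensive.

(** Source of a and b in part (B): the valuation of the even-index q-number splits as a + b. *)
Lemma qint_double (q h : nat) : 1 < q -> qint q h.*2 = (q + 1) * qint (q ^ 2) h.
Proof.
move=> q1; have q2 : 1 < q ^ 2 by rewrite -(exp1n 2) ltn_exp2r.
elim: h => [|h IH]; first by rewrite !qint0 muln0.
by rewrite doubleS !qintS // IH; ring.
Qed.

(** Double counting of flags determines the number of lines from q and the dimension alone, so [V]
    is compared with the row space without an isomorphism. *)
Lemma gauss_binom2 (F : finFieldType) (V : vectType F) n :
  \dim {:V} = n.+1 -> gauss_binom F n.+1 2 = #|grassmann_vertex V|.
Proof.
move=> dV; have dW : \dim {:'rV[F]_n.+1} = n.+1 by rewrite dimvf /dim /= mul1n.
have -> : gauss_binom F n.+1 2 = #|grassmann_vertex 'rV[F]_n.+1|.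
  by rewrite card_sub /gauss_binom cardsE.
have k0 : 0 < #|F| + 1 by rewrite addn1.
apply/eqP; rewrite -(eqn_pmul2r k0).
by rewrite (sum_incidences dV) (sum_incidences dW) !card_vpoint dV dW.
Qed.

(** In dimension at least 4, r >= q^2 + q + 1 >= 2 (q + 1), and N (q + 1) = P r then gives the
    second bound. It makes differences such as g - f + 2 genuine. *)
Lemma grassmann_counts (F : finFieldType) (V : vectType F) m :
  \dim {:V} = m.+4 ->
  2 < #|vpoint V| /\ 2 * #|vpoint V| <= #|grassmann_vertex V|.
Proof.
move=> dV; have q1 := card_finField_gt1 F; have flags := sum_incidences dV.
have rE : qint #|F| m.+3 = #|F| * (#|F| * qint #|F| m.+1 + 1) + 1 by rewrite !qintS.
have s0 : 0 < qint #|F| m.+1 by rewrite qintS // addn1.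
have PE : #|vpoint V| = #|F| * qint #|F| m.+3 + 1 by rewrite card_vpoint dV qintS.
have rbig : 2 * (#|F| + 1) <= qint #|F| m.+3 by rewrite rE; nia.
split; first by rewrite PE; nia.
have k0 : 0 < #|F| + 1 by rewrite addn1.
rewrite -(leq_pmul2r k0) flags.
by rewrite mulnAC mulnC leq_mul2l rbig orbT.
Qed.

End GrassmannCounts.

Theorem mainTheorem5 (p t n l : nat) (F : finFieldType) (V : vectType F)
    (d : seq int) :
  prime p -> 1 <= t -> 4 <= n ->
  #|F| = p ^ t -> \dim {:V} = n ->
  prime l -> l != p ->
  smith_diagonal (grassmann_laplacian V) d ->
  let q := p ^ t in
  let e := elemdiv_mult l d in
  let f := qint q n - 1 in
  let g := gauss_binom F n 2 - qint q n in
  (* (A) *)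
  (~~ (l %| q + 1) ->
    (~~ (l %| qint q n) -> ~~ (l %| qint q (n - 1)) ->
      exists2 N, has_order (critical_group (grassmann_laplacian V)) N
               & ~~ (l %| N)) /\
    (l %| qint q n \/ l %| qint q (n - 1) ->
      ~ (l %| qint q n /\ l %| qint q (n - 1))) /\
    (* (i) *)
    (l %| qint q n -> ~~ (l %| qint q (n - 1)) ->
      let a := logn l (qint q n) in
      mult_are e [:: (a, f - 1); (0, g + 1)]) /\
    (* (ii) *)
    (~~ (l %| qint q n) -> l %| qint q (n - 1) ->
      let a := logn l (qint q (n - 1)) in
      mult_are e [:: (a, g - 1); (0, f + 1)])) /\
  (* (B) *)
  (l %| q + 1 ->
    let a := logn l (q + 1) in
    (~~ (l %| qint q n) -> l %| qint q (n - 1) ->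
      odd n /\
      (* (i) *)
      (~~ (l %| qint (q ^ 2) ((n - 1) %/ 2)) ->
        mult_are e [:: (2 * a, g); (0, f)]) /\
      (* (ii) *)
      (l %| qint (q ^ 2) ((n - 1) %/ 2) ->
        let b := logn l (qint (q ^ 2) ((n - 1) %/ 2)) in
        mult_are e [:: (2 * a + b, g - 1); (2 * a, 1); (0, f)])) /\
    (l %| qint q n -> ~~ (l %| qint q (n - 1)) ->
      ~~ odd n /\
      (* (iii) *)
      (~~ (l %| qint (q ^ 2) (n %/ 2)) -> ~~ (l %| (n - 1) %/ 2) ->
        mult_are e [:: (2 * a, f - 1); (a, g - f + 2); (0, f - 1)]) /\
      (* (iv) *)
      (l %| qint (q ^ 2) (n %/ 2) ->
        let b := logn l (qint (q ^ 2) (n %/ 2)) in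
        mult_are e [:: (2 * a + b, f - 1); (a, g - f + 2); (0, f - 1)]) /\
      (* (v) *)
      (~~ (l %| qint (q ^ 2) (n %/ 2)) -> l %| (n - 1) %/ 2 ->
        mult_are e [:: (2 * a, f - 1); (a, g - f + 2); (0, f - 1)]))).
Proof.
move=> pp t1 n4 cF dV pl lp smd q e f g.
have q1 : 1 < q by rewrite /q -cF card_finField_gt1.
have q2 : 1 < q ^ 2 by rewrite -(exp1n 2) ltn_exp2r.
have l1 := prime_gt1 pl.
have [m nE] : exists m, n = m.+4.
  by exists (n - 4); clear -n4; lia.
have dV3 : \dim {:V} = m.+4 by rewrite dV.
have lap := grassmann_laplacian_steiner dV3; rewrite lap in smd *.
have SB := incidence_steiner dV3.
have exw := fun x y => @incidence_pencil_difference F V _ x y dV3.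
have [P2 PN] := grassmann_counts dV3.
have PE : qint q n = #|vpoint V| by rewrite card_vpoint dV cF.
have PrE : qint q n = q * qint q (n - 1) + 1 by rewrite nE subn1 qintS.
have NE : gauss_binom F n 2 = #|grassmann_vertex V| by rewrite nE (gauss_binom2 dV3).
have rE : qint #|F| m.+3 = qint q (n - 1) by rewrite cF nE subn1.
have lq : ~~ (l%:Z %| q%:R%R)%Z.
  by rewrite natz dvdzE /= Euclid_dvdX // negb_and dvdn_prime2 // lp.
have P1 := ltnW P2; have PltN : #|vpoint V| < #|grassmann_vertex V|.
  by clear -P2 PN; lia.
have logn0 := @logn_not_dvd l.
have logn_pos x : 0 < x -> l %| x -> 0 < logn l x.
  by move=> x0 lx; rewrite logn_gt0 mem_primes pl x0.
have qint_pos s j : 1 < s -> 0 < j -> 0 < qint s j.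
  by case: j => // j s1 _; rewrite qintS // addn1.
have not_both : l %| qint q (n - 1) -> ~~ (l %| qint q n).
  by move=> lr; rewrite PrE dvdn_addr ?dvdn_mull // dvdn1 neq_ltn l1 orbT.
have P_pos : 0 < qint q n by rewrite PE ltnW.
have r_pos : 0 < qint q (n - 1) by apply: qint_pos => //; clear -n4; lia.
move: SB smd exw; rewrite rE cF -/q => SB smd exw.
have -> : f = #|vpoint V| - 1 by rewrite /f PE.
have -> : g = #|grassmann_vertex V| - #|vpoint V| by rewrite /g PE NE.
split=> lk.
  split; first by rewrite PE => lP lr; apply: (steiner_critical_group_coprime SB pl smd).
  split; first by move=> _ [lP /not_both]; rewrite lP.
  split=> [lP lr | lP lr].
    apply: mult_are2; last exact: logn_pos.
    move=> j; rewrite /e (steiner_elemdiv_points SB pl smd) //.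
    by rewrite PE -subnDA.
  apply: mult_are2; last exact: logn_pos.
  move=> j; rewrite /e (steiner_elemdiv_replication SB pl smd) // -?PE //.
  by rewrite PE subnK // ltnW.
have a0 : 0 < logn l (q + 1) by apply: logn_pos => //; rewrite addn1.
split=> lP lr.
  have oddn : odd n.
    apply: contraR lP => en; rewrite -[n]odd_double_half (negPf en) qint_double //.
    exact: dvdn_mulr.
  have hE : ((n - 1) %/ 2).*2 = n - 1.
    by have := odd_double_half n; rewrite oddn -!muln2 /=; clear; lia.
  set h := (n - 1) %/ 2 in hE *.
  have h0 : 0 < h by rewrite -double_gt0 hE; clear -n4; lia.
  have vr : logn l (qint q (n - 1)) = logn l (q + 1) + logn l (qint (q ^ 2) h).
    by rewrite -hE qint_double // lognM ?addn1 // qint_pos.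
  have eE := steiner_elemdiv_not_dvd_points SB pl smd P1 PltN.
  rewrite -PE vr in eE; have {}eE := eE lP (leq_addr _ _).
  split=> //; split=> lh.
    (* Here b = 0, so the exponents 2a and 2a + b coincide and their multiplicities 1 and g - 1 add
       up to g. *)
    apply: mult_are2; last by rewrite muln_gt0.
    move=> j; rewrite /e eE (logn0 _ lh) addn0 addnn -mul2n PE -addnA -mulnDr.
    by congr (_ + _ * _); clear -P1 PltN; lia.
  apply: mult_are3.
  - by move=> j; rewrite /e eE PE addnA addnn -mul2n.
  - by rewrite muln_gt0.
  - by rewrite -[X in X < _]addn0 ltn_add2l logn_pos // qint_pos.
have evenn : ~~ odd n.
  apply: contra lr => on; have -> : n - 1 = n./2.*2.
    by have := odd_double_half n; rewrite on -!muln2; clear; lia.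
  by rewrite qint_double // dvdn_mulr.
have hE : (n %/ 2).*2 = n by have := odd_double_half n; rewrite (negPf evenn) divn2.
set h := n %/ 2 in hE *.
have h0 : 0 < h by rewrite -double_gt0 hE; clear -n4; lia.
have vP : logn l #|vpoint V| = logn l (q + 1) + logn l (qint (q ^ 2) h).
  by rewrite -PE -{1}hE qint_double // lognM ?addn1 // qint_pos.
have PN3 : 2 * #|vpoint V| <= #|grassmann_vertex V| + 3.
  exact: leq_trans PN (leq_addr _ _).
have eE := @steiner_elemdiv_dvd_points _ _ _ _ _ SB _ _ pl smd P1 PltN q%:R%R PN3.
rewrite vP in eE; rewrite PE in lP; have {}eE := eE lP lr (leq_addr _ _) lq exw.
(* One formula covers (iii), (iv) and (v): the valuation of [n] is a + b, with b = 0 in (iii) and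
   (v). *)
have multE : mult_are e
  [:: (2 * logn l (q + 1) + logn l (qint (q ^ 2) h), #|vpoint V| - 1 - 1);
    (logn l (q + 1), #|grassmann_vertex V| - #|vpoint V| - (#|vpoint V| - 1) + 2);
    (0, #|vpoint V| - 1 - 1)].
  apply: mult_are3 => //; last first.
    by rewrite mul2n -addnn -addnA -[X in X < _]addn0 ltn_add2l addn_gt0 a0.
  move=> j; rewrite /e eE addnA addnn -mul2n.
  by congr (_ * _ + _ * _ + _ * _); clear -P2 PN; lia.
split=> //; split; last split=> //.
- by move=> lh _; move: multE; rewrite (logn0 _ lh) addn0.
- by move=> lh _; move: multE; rewrite (logn0 _ lh) addn0.
Qed.
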